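(* Fix $\alpha\in(0,1)$. (Direct part.) For any $C>0$ there exists $C'>0$ such that if $\phi\in\mathrm{Diff}^1(\mathbb{T})$ satisfies $|\log\phi'(t)-\log\phi'(s)|<C\,\mathsf{d}(s,t)^{\alpha}$ for all distinct $s,t\in\mathbb{T}$, then (the class of) $\phi$ belongs to $\mathsf{H\ddot{o}l}^{\alpha}(C')$. Furthermore, $C'=C'(C)$ can be chosen so that $C'\to0$ as $C\to0$. (Converse part.) Fix $\varepsilon>0$. Then for any $C'>0$ there exists $C''>0$ such that if $\phi\in\widetilde{\mathrm{Diff}}{}^1(\mathbb{T})$ and $$\left|\mathcal{O}(\phi;s,t)-\frac{\pi}{\sin(\pi[t-s])}\right|\le C'\,\mathsf{d}(s,t)^{\alpha-1}$$ for all distinct $s,t\in\mathbb{T}$ with $\mathsf{d}(s,t)<\varepsilon$, then $|\log\phi'(t)-\log\phi'(s)|<C''\,\mathsf{d}(s,t)^{\alpha}$ for all distinct $s,t\in\mathbb{T}$. Moreover, if $\varepsilon>1$ (i.e. the displayed inequality holds for all distinct $s,t\in\mathbb{T}$), then $C''=C''(C')$ can be chosen so that $C''\to0$ as $C'\to0$.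
   Context: $\mathbb{T}=[0,1]/\{0\sim1\}$ is the unit circle; for $s,t\in\mathbb{T}$, $t-s\in[0,1)$ denotes the length of the arc going from $s$ to $t$ in the positive direction, and $\mathsf{d}(s,t)=\min\{t-s,1-(t-s)\}$. $\mathrm{Diff}^1(\mathbb{T})$ is the space of orientation preserving $C^1$-diffeomorphisms of $\mathbb{T}$ with the $C^1$ topology. $\mathrm{PSL}(2,\mathbb{R})$ is the group of conformal automorphisms of the unit disk restricted to the boundary (identified with $\mathbb{T}$ via $t\mapsto e^{2\pi i t}$), acting on $\mathrm{Diff}^1(\mathbb{T})$ by post-composition; $\mathrm{Diff}^1(\mathbb{T})/\mathrm{PSL}(2,\mathbb{R})$ is the quotient. For $\phi\in\mathrm{Diff}^1(\mathbb{T})$ and distinct $s,t\in\mathbb{T}$ the cross-ratio observable is $$\mathcal{O}(\phi;s,t)=\frac{\pi\sqrt{\phi'(t)\phi'(s)}}{\sin(\pi[\phi(t)-\phi(s)])},$$ where $\phi(t)-\phi(s)\in(0,1)$; it is invariant under $\phi\mapsto\psi\circ\phi$, $\psi\in\mathrm{PSL}(2,\mathbb{R})$, hence is defined on the quotient. For $\alpha>0$ and $K>0$, $\mathsf{H\ddot{o}l}^{\alpha}(K)$ is the set of $\phi\in\mathrm{Diff}^1(\mathbb{T})/\mathrm{PSL}(2,\mathbb{R})$ such that $\left|\mathcal{O}(\phi;s,t)-\frac{\pi}{\sin(\pi[t-s])}\right|\le K\,\mathsf{d}(s,t)^{\alpha-1}$ for all distinct $s,t\in\mathbb{T}$. $\widetilde{\mathrm{Diff}}{}^1(\mathbb{T})=\{\phi\in\mathrm{Diff}^1(\mathbb{T}):\phi(0)=0,\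 \phi(1/3)=1/3,\ \phi(2/3)=2/3\}$. *)

(* Defs.v *)
From Stdlib Require Import Reals Lra.
From Coquelicot Require Import Coquelicot.

Open Scope R_scope.

(* The circle [0,1]/{0~1}: each point is given by its representative in [0,1). *)
Record circle : Type := Circle {
  crep : R;
  crep_bounds : 0 <= crep < 1
}.

Lemma frac_part_bounds (x : R) : 0 <= frac_part x < 1.
Proof. destruct (base_fp x); lra. Qed.

Definition cproj (x : R) : circle := Circle (frac_part x) (frac_part_bounds x).

(* The length t - s in [0,1) of the positively oriented arc from s to t. *)
Definition arc (s t : circle) : R := frac_part (crep t - crep s).

Definition cdist (s t : circle) : R := Rmin (arc s t) (1 - arc s t).

(* The representative of t - s in [-1/2, 1/2). *)
Definition sarc (s t : circle) : R :=
  frac_part (crep t - crep s + 1 / 2) - 1 / 2.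

(* For phi continuous at t and h small, this is the increment
   phi(t + h) - phi(t) computed in a local lift. *)
Definition increment (phi : circle -> circle) (t : circle) (h : R) : R :=
  sarc (phi t) (phi (cproj (crep t + h))).

Definition cderive (phi : circle -> circle) (t : circle) : R :=
  Derive (increment phi t) 0.

(* Differentiability of the increment at 0 entails continuity of phi. *)
Definition is_C1 (phi : circle -> circle) : Prop :=
  (forall t, ex_derive (increment phi t) 0) /\
  (forall x : R, continuous (fun u : R => cderive phi (cproj u)) x).

Record Diff1 : Type := MkDiff1 {
  diff_map :> circle -> circle;
  diff_C1 : is_C1 diff_map;
  diff_inverse : exists psi : circle -> circle,
    is_C1 psi /\
    (forall t, psi (diff_map t) = t) /\ (forall t, diff_map (psi t) = t);
  diff_oriented : forall t, 0 < cderive diff_map t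
}.

(* The point e^{2 pi i t} of the unit circle. *)
Definition expi (t : circle) : C :=
  (cos (2 * PI * crep t), sin (2 * PI * crep t)).

(* The conformal automorphisms of the unit disk are the maps
   z |-> e^{2 pi i a} (z - w) / (1 - conj(w) z) with |w| < 1; PSL(2,R) consists
   of their boundary values, read on the circle through [expi]. *)
Definition PSL2R (psi : circle -> circle) : Prop :=
  exists (a : circle) (w : C), Cmod w < 1 /\
    forall t, expi (psi t) =
      (expi a * ((expi t - w) / (1 - Cconj w * expi t)))%C.

Definition PSL_orbit (phi : Diff1) : Diff1 -> Prop :=
  fun chi => exists psi, PSL2R psi /\ forall t, chi t = psi (phi t).

(* Diff^1(T)/PSL(2,R), as the type of orbits for post-composition. *)
Definition Diff1_PSL : Type :=
  { c : Diff1 -> Prop | exists phi, c = PSL_orbit phi }.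

Definition PSL_class (phi : Diff1) : Diff1_PSL :=
  exist _ (PSL_orbit phi) (ex_intro _ phi eq_refl).

Definition cross_ratio (phi : Diff1) (s t : circle) : R :=
  PI * sqrt (cderive phi t * cderive phi s) / sin (PI * arc (phi s) (phi t)).

Definition cross_ratio_bound (alpha K : R) (phi : Diff1) (s t : circle) : Prop :=
  Rabs (cross_ratio phi s t - PI / sin (PI * arc s t))
    <= K * Rpower (cdist s t) (alpha - 1).

(* The cross-ratio observable is constant on orbits; its value on an orbit c is
   its value at any representative, whence the quantification over all of them
   (an orbit is never empty). *)
Definition Hol (alpha K : R) (c : Diff1_PSL) : Prop :=
  forall phi : Diff1, proj1_sig c phi ->
  forall s t : circle, s <> t -> cross_ratio_bound alpha K phi s t.

Definition log_deriv_holder (alpha K : R) (phi : Diff1) : Prop :=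
  forall s t : circle, s <> t ->
    Rabs (ln (cderive phi t) - ln (cderive phi s))
      < K * Rpower (cdist s t) alpha.

Definition Diff1_tilde (phi : Diff1) : Prop :=
  phi (cproj 0) = cproj 0 /\
  phi (cproj (1 / 3)) = cproj (1 / 3) /\
  phi (cproj (2 / 3)) = cproj (2 / 3).

(* Main.v *)
Require Import Defs.
From Stdlib Require Import ZArith Reals Lra Lia ProofIrrelevance ClassicalEpsilon.
From Coquelicot Require Import Coquelicot.
Open Scope R_scope.

(* Everything is read on a lift [F] of [phi], with [f = F'].

   Direct part: if [log f] is Hoelder, the mean value theorem gives
   [F y - F x = f xi * (y - x)], so the ratio of [sqrt (f x * f y)] to the
   difference quotient is [1 + O(C |y-x|^a)]; the remaining discrepancy is that
   of [sin (PI u) / u], which is Lipschitz.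

   Converse part: the planar curve [U = (cos (PI F), sin (PI F)) / sqrt f] has
   [U x /\ U y = PI / cross_ratio], which is [sin (PI (y - x))] up to
   [O(C' |y-x|^(1+a))], and [|U|^2 = 1 / f].  The relation between three vectors
   of a plane, at equally spaced points, shows that the deviation of [U] from
   [(cos (PI x), sin (PI x))] has second differences [O(h^a)] as soon as it is
   bounded; by Zygmund's argument ([a < 1]) it is then Hoelder.  It is bounded
   because the wedge at distance [1/3] satisfies a Harnack inequality, so that the
   normalisation at [0, 1/3, 2/3] controls the three lengths [|U|] there; when [C']
   is small and the hypothesis is global, it is directly [O(C')]. *)

(** * Circle and lifts *)

Lemma circle_eq (s t : circle) : crep s = crep t -> s = t.
Proof.
destruct s as [a Ha]; destruct t as [b Hb]; simpl; intro E; subst b.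
f_equal; apply proof_irrelevance.
Qed.

Lemma frac_part_unique (x : R) (n : Z) :
  0 <= x - IZR n < 1 -> frac_part x = x - IZR n.
Proof.
intro H; unfold frac_part.
rewrite <- (Int_part_spec x n); [reflexivity | lra].
Qed.

Lemma frac_part_spec (x : R) : exists n : Z, frac_part x = x - IZR n.
Proof. exists (Int_part x); reflexivity. Qed.

Lemma cproj_crep (t : circle) : cproj (crep t) = t.
Proof.
apply circle_eq; simpl.
rewrite (frac_part_unique _ 0); [lra | pose proof (crep_bounds t); lra].
Qed.

Lemma cproj_shift (x y : R) (n : Z) : y = x + IZR n -> cproj y = cproj x.
Proof.
intro E; apply circle_eq; simpl.
destruct (frac_part_spec x) as [m Hm].
pose proof (frac_part_bounds x).
rewrite (frac_part_unique y (m + n)); rewrite plus_IZR; lra.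
Qed.

Lemma cproj_inj (x y : R) : cproj x = cproj y -> exists n : Z, y = x + IZR n.
Proof.
intro E; apply (f_equal crep) in E; simpl in E.
destruct (frac_part_spec x) as [m Hm]; destruct (frac_part_spec y) as [k Hk].
exists (k - m)%Z; rewrite minus_IZR; lra.
Qed.

Lemma arc_cproj (x y : R) : 0 <= y - x < 1 -> arc (cproj x) (cproj y) = y - x.
Proof.
intro H; unfold arc; simpl.
destruct (frac_part_spec x) as [m Hm]; destruct (frac_part_spec y) as [k Hk].
rewrite (frac_part_unique _ (m - k)); rewrite minus_IZR; lra.
Qed.

Lemma cdist_cproj (x y : R) :
  0 <= y - x < 1 -> cdist (cproj x) (cproj y) = Rmin (y - x) (1 - (y - x)).
Proof. intro H; unfold cdist; rewrite arc_cproj; trivial. Qed.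

Lemma cproj_neq (x y : R) : x < y < x + 1 -> cproj x <> cproj y.
Proof.
intros H E; destruct (cproj_inj _ _ E) as [n Hn].
assert (0 < n)%Z by (apply lt_IZR; lra).
assert (n < 1)%Z by (apply lt_IZR; lra).
lia.
Qed.

Lemma cproj_cover (s t : circle) :
  s <> t -> exists x y, s = cproj x /\ t = cproj y /\ x < y < x + 1.
Proof.
intro H.
pose proof (crep_bounds s); pose proof (crep_bounds t).
destruct (Rtotal_order (crep s) (crep t)) as [L | [L | L]].
- exists (crep s), (crep t); rewrite !cproj_crep; repeat split; lra.
- destruct H; now apply circle_eq.
- exists (crep s), (crep t + 1).
  rewrite (cproj_shift (crep t) (crep t + 1) 1), !cproj_crep by reflexivity.
  repeat split; lra.
Qed.

Record circle_lift (F f : R -> R) : Prop := {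
  lift_derive : forall x, is_derive F x (f x);
  lift_pos : forall x, 0 < f x;
  lift_period : forall x, F (x + 1) = F x + 1;
  deriv_period : forall x, f (x + 1) = f x
}.

Lemma derive_pos_lt (F f : R -> R) :
  (forall x, is_derive F x (f x)) -> (forall x, 0 < f x) ->
  forall x y, x < y -> F x < F y.
Proof.
intros HF Hf x y H.
destruct (MVT_cor2 F f x y H) as [c [Hc _]].
{ intros c _; apply is_derive_Reals, HF. }
pose proof (Rmult_lt_0_compat _ _ (Hf c) (proj2 (Rlt_0_minus x y) H)); lra.
Qed.

Lemma sarc_spec (s t : circle) :
  exists n : Z, sarc s t = crep t - crep s + IZR n.
Proof.
unfold sarc.
destruct (frac_part_spec (crep t - crep s + 1 / 2)) as [n Hn].
exists (- n)%Z; rewrite opp_IZR; lra.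
Qed.

Lemma cos_period_Z (x : R) (n : Z) : cos (x + 2 * PI * IZR n) = cos x.
Proof.
assert (E : forall k : nat, cos (2 * PI * IZR (Z.of_nat k)) = 1 /\
                      sin (2 * PI * IZR (Z.of_nat k)) = 0).
{ intro k; rewrite <- INR_IZR_INZ.
  replace (2 * PI * INR k) with (0 + 2 * INR k * PI) by ring.
  rewrite cos_period, sin_period, cos_0, sin_0; auto. }
assert (E' : cos (2 * PI * IZR n) = 1 /\ sin (2 * PI * IZR n) = 0).
{ destruct (Z.le_gt_cases 0 n) as [H | H].
  - rewrite <- (Z2Nat.id n H); apply E.
  - replace n with (- Z.of_nat (Z.to_nat (- n)))%Z by lia.
    destruct (E (Z.to_nat (- n))) as [E1 E2].
    rewrite opp_IZR, <- Ropp_mult_distr_r, cos_neg, sin_neg; lra. }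
rewrite cos_plus; destruct E' as [-> ->]; ring.
Qed.

Lemma cos_2PI_eq_1 (x : R) : cos (2 * PI * x) = 1 -> exists n : Z, x = IZR n.
Proof.
intro H; replace (2 * PI * x) with (2 * (PI * x)) in H by ring.
rewrite cos_2a_sin in H.
assert (sin (PI * x) = 0) as E by nra.
destruct (sin_eq_0_0 _ E) as [n Hn]; exists n.
pose proof PI_RGT_0.
apply (Rmult_eq_reg_l PI); lra.
Qed.

(** Integrating the derivative from the representative of [phi (cproj 0)] gives the candidate [F].
    That it lifts [phi] is tested through a cosine of period 1, which is blind to the integer jumps
    of [crep] and along which the derivative vanishes. *)
Lemma diff_lift (phi : Diff1) :
  exists F : R -> R, F 0 = crep (phi (cproj 0)) /\
    (forall x, phi (cproj x) = cproj (F x)) /\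
    circle_lift F (fun x => cderive phi (cproj x)).
Proof.
set (f := fun x => cderive phi (cproj x)).
destruct (diff_C1 phi) as [Hd Hc].
set (F := fun x => crep (phi (cproj 0)) + RInt f 0 x).
assert (HF : forall x, is_derive F x (f x)).
{ intro x; unfold F.
  replace (f x) with (0 + f x) by ring.
  apply (is_derive_plus (fun _ => crep (phi (cproj 0))) (RInt f 0)).
  - apply (is_derive_const (K := R_AbsRing) (V := R_NormedModule)).
  - apply is_derive_RInt with 0.
    + apply filter_forall; intro y; apply (RInt_correct f).
      apply (ex_RInt_continuous f); intros z _; apply Hc.
    + apply Hc. }
assert (Hf : forall x, 0 < f x) by (intro x; apply diff_oriented).
assert (Hp : forall x, f (x + 1) = f x).
{ intro x; unfold f; now rewrite (cproj_shift x (x + 1) 1). }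
assert (F0 : F 0 = crep (phi (cproj 0))).
{ unfold F; rewrite RInt_point; unfold zero; simpl; ring. }
assert (G : forall x, cos (2 * PI * (crep (phi (cproj x)) - F x)) = 1).
{ set (g := fun x => cos (2 * PI * (crep (phi (cproj x)) - F x))).
  assert (Hg : forall x, is_derive g x 0).
  { intro x.
    set (t := cproj x).
    (* The jumping representative is traded for the local lift [increment], which is differentiable
       at 0; the two differ by an integer, absorbed by the cosine. *)
    apply (is_derive_ext (fun y =>
      cos (2 * PI * (crep (phi t) + increment phi t (y - x) - F y)))).
    { intro y; unfold g, increment.
      rewrite (cproj_shift y (crep t + (y - x)) (- Int_part x)).
      2:{ unfold t; simpl; unfold frac_part; rewrite opp_IZR; ring. }
      destruct (sarc_spec (phi t) (phi (cproj y))) as [n Hn]; rewrite Hn.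
      rewrite <- (cos_period_Z (2 * PI * (crep (phi (cproj y)) - F y)) n).
      f_equal; ring. }
    pose proof (Derive_correct _ _ (Hd t)) as D.
    assert (D' : is_derive (fun y =>
       crep (phi t) + increment phi t (y - x) - F y) x 0).
    { evar_last.
      - apply (is_derive_minus (fun y => crep (phi t) + increment phi t (y - x)) F);
          [apply (is_derive_plus (fun _ => crep (phi t)));
             [apply (is_derive_const (K := R_AbsRing) (V := R_NormedModule)) |]
          | apply HF].
        apply (is_derive_comp (increment phi t) (fun y => y - x)).
        + replace (x - x) with 0 by ring; apply D.
        + auto_derive; [trivial | reflexivity].
      - unfold f, cderive, t, minus, plus, opp, scal, mult, zero; simpl.
        unfold mult; simpl; ring. }
    evar_last.
    - apply (is_derive_comp cos (fun y =>
        2 * PI * (crep (phi t) + increment phi t (y - x) - F y))).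
      + apply is_derive_cos.
      + apply (is_derive_scal _ x (2 * PI)), D'.
    - unfold scal; simpl; unfold mult; simpl; ring. }
  assert (g0 : g 0 = 1).
  { unfold g; rewrite F0, Rminus_diag, Rmult_0_r; apply cos_0. }
  intro x; fold (g x).
  destruct (Rtotal_order x 0) as [L | [L | L]].
  - rewrite (eq_is_derive g x 0); auto.
  - now rewrite L.
  - rewrite <- (eq_is_derive g 0 x); auto. }
assert (L : forall x, phi (cproj x) = cproj (F x)).
{ intro x; destruct (cos_2PI_eq_1 _ (G x)) as [n Hn].
  rewrite (cproj_shift (crep (phi (cproj x))) (F x) (- n)).
  - now rewrite cproj_crep.
  - rewrite opp_IZR; lra. }
assert (Inj : forall x y, cproj (F x) = cproj (F y) -> cproj x = cproj y).
{ intros x y; rewrite <- !L.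
  destruct (diff_inverse phi) as [psi [_ [K _]]]; intro E.
  rewrite <- (K (cproj x)), E; apply K. }
assert (Inc := derive_pos_lt F f HF Hf).
(* The degree is a positive integer; were it at least 2, [F] would reach [F 0 + 1] strictly between
   0 and 1, against the injectivity of [phi]. *)
assert (P0 : F 1 = F 0 + 1).
{ destruct (cproj_inj (F 0) (F 1)) as [n Hn].
  { rewrite <- !L; now rewrite (cproj_shift 0 1 1) by ring. }
  pose proof (Inc 0 1 Rlt_0_1).
  assert (n0 : (0 < n)%Z) by (apply lt_IZR; lra).
  destruct (Z.eq_dec n 1) as [-> | n1]; [exact Hn|].
  assert (n2 : 2 <= IZR n) by (apply IZR_le; lia).
  destruct (IVT_gen F 0 1 (F 0 + 1)) as [y [Hy Ey]].
  { intro z; apply continuity_pt_filterlim.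
    apply (ex_derive_continuous F z); eexists; apply HF. }
  { rewrite Rmin_left, Rmax_right; lra. }
  rewrite Rmin_left, Rmax_right in Hy by lra.
  assert (y <> 0) by (intro; subst; lra).
  assert (y <> 1) by (intro; subst; lra).
  exfalso; apply (cproj_neq 0 y); [lra|].
  apply Inj; now rewrite Ey, (cproj_shift (F 0) (F 0 + 1) 1). }
exists F; split; [exact F0 | split; [exact L | split; trivial]].
set (g := fun x => F (x + 1) - F x).
assert (Hg : forall x, is_derive g x 0).
{ intro x; unfold g; evar_last.
  - apply (is_derive_minus (fun x => F (x + 1)) F); [|apply HF].
    apply (is_derive_comp F (fun x => x + 1)); [apply HF|].
    auto_derive; [trivial | reflexivity].
  - rewrite Hp; unfold minus, plus, opp, scal; simpl; unfold mult; simpl; ring. }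
intro x; cut (g x = 1); [unfold g; lra|].
assert (g0 : g 0 = 1) by (unfold g; rewrite Rplus_0_l; lra).
destruct (Rtotal_order x 0) as [M | [M | M]].
- rewrite (eq_is_derive g x 0); auto.
- now rewrite M.
- rewrite <- (eq_is_derive g 0 x); auto.
Qed.

(** * Invariance of the cross ratio under PSL(2,R) *)

Lemma lift_increment (F f : R -> R) (x y : R) :
  circle_lift F f -> x < y < x + 1 -> 0 < F y - F x < 1.
Proof.
intros [HF Hf Hp _] H.
pose proof (derive_pos_lt F f HF Hf x y).
pose proof (derive_pos_lt F f HF Hf y (x + 1)).
rewrite Hp in *; lra.
Qed.

Lemma sin_PI_pos (x : R) : 0 < x < 1 -> 0 < sin (PI * x).
Proof. intro H; pose proof PI_RGT_0; apply sin_gt_0; nra. Qed.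

Lemma cross_ratio_lift (phi : Diff1) (F : R -> R) (x y : R) :
  (forall x, phi (cproj x) = cproj (F x)) ->
  circle_lift F (fun x => cderive phi (cproj x)) ->
  x < y < x + 1 ->
  cross_ratio phi (cproj x) (cproj y) =
  PI * sqrt (cderive phi (cproj y) * cderive phi (cproj x))
    / sin (PI * (F y - F x)).
Proof.
intros L HL H; unfold cross_ratio; rewrite !L, arc_cproj; [reflexivity|].
pose proof (lift_increment _ _ x y HL H); lra.
Qed.

Lemma expi_cproj (x : R) : expi (cproj x) = (cos (2 * PI * x), sin (2 * PI * x)).
Proof.
unfold expi; simpl; destruct (frac_part_spec x) as [n Hn]; rewrite Hn.
f_equal.
- rewrite <- (cos_period_Z _ n); f_equal; ring.
- rewrite <- !cos_shift, <- (cos_period_Z _ (- n)), opp_IZR.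
  f_equal; ring.
Qed.

Lemma Cmod_sqr (z : C) : Cmod z ^ 2 = fst z ^ 2 + snd z ^ 2.
Proof. unfold Cmod; rewrite pow2_sqrt; nra. Qed.

Lemma Cmod_expi (t : circle) : Cmod (expi t) = 1.
Proof.
unfold Cmod, expi; simpl.
pose proof (sin2_cos2 (2 * PI * crep t)) as E; unfold Rsqr in E.
replace (_ + _) with 1 by lra; apply sqrt_1.
Qed.

(** A chord of the unit circle is twice the absolute sine of half its angle; squaring spares the
    absolute value. *)
Lemma chord_sqr (a b : R) :
  Cmod (expi (cproj b) - expi (cproj a)) ^ 2 = 4 * sin (PI * (b - a)) ^ 2.
Proof.
rewrite Cmod_sqr, !expi_cproj; simpl.
pose proof (sin2_cos2 (2 * PI * a)) as Ea.
pose proof (sin2_cos2 (2 * PI * b)) as Eb.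
pose proof (cos_2a_sin (PI * (b - a))) as Es.
replace (2 * (PI * (b - a))) with (2 * PI * b - 2 * PI * a) in Es by ring.
rewrite cos_minus in Es; unfold Rsqr in *; nra.
Qed.

Lemma mobius_denom_neq0 (w z : C) :
  Cmod w < 1 -> Cmod z = 1 -> (1 - Cconj w * z)%C <> 0.
Proof.
intros Hw Hz E.
assert (E' : (Cconj w * z)%C = 1%C).
{ replace (Cconj w * z)%C with (1 - (1 - Cconj w * z))%C by ring.
  rewrite E; ring. }
apply (f_equal Cmod) in E'.
rewrite Cmod_mult, Cmod_conj, Hz, Cmod_1 in E'; lra.
Qed.

(** Algebraically, the two values differ by [a] times (1 - |w|^2)(z2 - z1) over the product of the
    two denominators; moduli are then taken. *)
Lemma mobius_chord (a w z1 z2 : C) :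
  Cmod w < 1 -> Cmod a = 1 -> Cmod z1 = 1 -> Cmod z2 = 1 ->
  Cmod (a * ((z2 - w) / (1 - Cconj w * z2)) - a * ((z1 - w) / (1 - Cconj w * z1)))
    * (Cmod (1 - Cconj w * z1) * Cmod (1 - Cconj w * z2))
  = (1 - Cmod w ^ 2) * Cmod (z2 - z1).
Proof.
intros Hw Ha H1 H2.
rewrite <- !Cmod_mult.
pose proof (mobius_denom_neq0 w z1 Hw H1); pose proof (mobius_denom_neq0 w z2 Hw H2).
replace (_ * _)%C with (a * (RtoC (1 - Cmod w ^ 2) * (z2 - z1)))%C.
- rewrite !Cmod_mult, Ha, Cmod_R, Rabs_pos_eq; [ring|].
  pose proof (Cmod_ge_0 w); nra.
- rewrite Cmod_sqr.
  replace (RtoC (1 - (fst w ^ 2 + snd w ^ 2))) with (1 - w * Cconj w)%C.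
  + field; auto.
  + destruct w; unfold Cconj; apply injective_projections; simpl; ring.
Qed.

(** This is |1 - conj(w) z|^2 at z = e^{2 pi i u}, the denominator of the Poisson kernel, expanded
    as a trigonometric polynomial so that it can be differentiated in [u]. *)
Definition mobius_weight (w : C) (u : R) : R :=
  1 + Cmod w ^ 2 - 2 * (fst w * cos (2 * PI * u) + snd w * sin (2 * PI * u)).

Lemma mobius_weight_Cmod (w : C) (u : R) :
  mobius_weight w u = Cmod (1 - Cconj w * expi (cproj u)) ^ 2.
Proof.
unfold mobius_weight; rewrite !Cmod_sqr, expi_cproj; destruct w as [p q]; simpl.
pose proof (sin2_cos2 (2 * PI * u)) as E; unfold Rsqr in E.
replace (cos (2 * PI * u) * cos (2 * PI * u))
  with (1 - sin (2 * PI * u) * sin (2 * PI * u)) by lra.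
nra.
Qed.

Lemma mobius_weight_pos (w : C) (u : R) : Cmod w < 1 -> 0 < mobius_weight w u.
Proof.
intro Hw; rewrite mobius_weight_Cmod; apply pow_lt, Cmod_gt_0.
now apply mobius_denom_neq0, Cmod_expi.
Qed.

(** The chord identity of Moebius maps, read on real representatives. It stays squared because the
    sines have no fixed sign for arbitrary representatives. *)
Lemma PSL2R_sin (psi : circle -> circle) :
  PSL2R psi -> exists w : C, Cmod w < 1 /\
  forall a b a' b' : R, psi (cproj a) = cproj a' -> psi (cproj b) = cproj b' ->
    (sin (PI * (b' - a')) * sqrt (mobius_weight w a * mobius_weight w b)) ^ 2
    = ((1 - Cmod w ^ 2) * sin (PI * (b - a))) ^ 2.
Proof.
intros [c [w [Hw H]]]; exists w; split; trivial.
intros a b a' b' Ea Eb.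
pose proof (mobius_chord (expi c) w (expi (cproj a)) (expi (cproj b)) Hw
  (Cmod_expi _) (Cmod_expi _) (Cmod_expi _)) as E.
rewrite <- !H, Ea, Eb in E.
apply (f_equal (fun r => r ^ 2)) in E.
rewrite !Rpow_mult_distr, !chord_sqr, <- !mobius_weight_Cmod in E.
rewrite !Rpow_mult_distr, pow2_sqrt.
- lra.
- pose proof (mobius_weight_pos w a Hw); pose proof (mobius_weight_pos w b Hw); nra.
Qed.

(** On lifts the sines are positive, so the chord identity loses its squares ([S]). Its
    infinitesimal form on the diagonal ([D]) relates [g] to [f], and the weight [m] and the factor
    [k] then cancel from the quotient. *)
Lemma PSL2R_lift (psi : circle -> circle) (F f G g : R -> R) :
  PSL2R psi -> circle_lift F f -> circle_lift G g ->
  (forall x, psi (cproj (F x)) = cproj (G x)) ->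
  forall x y, x < y < x + 1 ->
  sqrt (g y * g x) / sin (PI * (G y - G x)) = sqrt (f y * f x) / sin (PI * (F y - F x)).
Proof.
intros Hpsi HF HG E.
destruct (PSL2R_sin psi Hpsi) as [w [Hw Hs]].
set (m := fun x => mobius_weight w (F x)); set (k := 1 - Cmod w ^ 2).
assert (mp : forall x, 0 < m x) by (intro x; now apply mobius_weight_pos).
assert (kp : 0 < k) by (unfold k; pose proof (Cmod_ge_0 w); nra).
assert (S : forall x y, x < y < x + 1 ->
  sin (PI * (G y - G x)) * sqrt (m x * m y) = k * sin (PI * (F y - F x))).
{ intros x y H.
  pose proof (sin_PI_pos _ (lift_increment _ _ x y HF H)).
  pose proof (sin_PI_pos _ (lift_increment _ _ x y HG H)).
  pose proof (Hs (F x) (F y) (G x) (G y) (E x) (E y)) as Q.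
  fold k in Q; fold (m x) in Q; fold (m y) in Q.
  pose proof (sqrt_pos (m x * m y)).
  assert (0 <= sin (PI * (G y - G x)) * sqrt (m x * m y)) by nra.
  assert (0 < k * sin (PI * (F y - F x))) by nra.
  nra. }
assert (D : forall x, g x * m x = k * f x).
{ intro x.
  (* [P] vanishes near [x]: by [S] on the right, and by oddness of the sine on the left. Its
     derivative at [x] is [PI] times the difference of the two sides, since the square root equals
     [m x] there and its own derivative is multiplied by [sin 0]. *)
  set (P := fun y => sin (PI * (G y - G x)) * sqrt (m x * m y) - k * sin (PI * (F y - F x))).
  assert (DP : is_derive P x (PI * (g x * m x - k * f x))).
  { pose proof (lift_derive _ _ HF x) as DF; pose proof (lift_derive _ _ HG x) as DG.
    pose proof (mp x) as mx.
    unfold P, m, mobius_weight.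
    set (c := fst w * cos (2 * PI * F x) + snd w * sin (2 * PI * F x)).
    assert (m1 : 1 + Cmod w * (Cmod w * 1) + - (2 * c) = m x) by reflexivity.
    assert (m2 : 1 + Cmod w * (Cmod w * 1) - 2 * c = m x) by reflexivity.
    auto_derive; fold c.
    - rewrite m1, m2.
      repeat split; try (eexists; eassumption); nra.
    - rewrite m1, m2.
      change (Derive (fun x0 => F x0) x) with (Derive F x).
      change (Derive (fun x0 => G x0) x) with (Derive G x).
      rewrite (is_derive_unique _ _ _ DF), (is_derive_unique _ _ _ DG).
      rewrite !Rplus_opp_r, !Rmult_0_r, sin_0, cos_0, sqrt_square by lra.
      replace (1 + Cmod w ^ 2 - 2 * c) with (m x) by reflexivity.
      ring. }
  assert (DP0 : is_derive P x 0).
  { apply (is_derive_ext_loc (fun _ => 0)).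
    - exists (mkposreal 1 Rlt_0_1); intros y Hy.
      apply Rabs_def2 in Hy; unfold minus, plus, opp in Hy; simpl in Hy.
      change (@eq R 0 (P y)); unfold P.
      destruct (Rtotal_order x y) as [L | [L | L]].
      + rewrite S; lra.
      + subst y; rewrite !Rminus_diag, !Rmult_0_r, sin_0; ring.
      + pose proof (S y x ltac:(lra)) as Sy.
        replace (PI * (G y - G x)) with (- (PI * (G x - G y))) by ring.
        replace (PI * (F y - F x)) with (- (PI * (F x - F y))) by ring.
        rewrite !sin_neg, Rmult_comm, (Rmult_comm (m x)); lra.
    - apply (is_derive_const (K := R_AbsRing) (V := R_NormedModule)). }
  apply is_derive_unique in DP; apply is_derive_unique in DP0.
  rewrite DP in DP0; pose proof PI_RGT_0; nra. }
intros x y H.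
pose proof (sin_PI_pos _ (lift_increment _ _ x y HF H)).
pose proof (sin_PI_pos _ (lift_increment _ _ x y HG H)).
pose proof (S x y H) as Sxy.
pose proof (mp x); pose proof (mp y).
pose proof (lift_pos _ _ HF x); pose proof (lift_pos _ _ HF y).
pose proof (lift_pos _ _ HG x); pose proof (lift_pos _ _ HG y).
assert (Q : sqrt (g y * g x) * sqrt (m x * m y) = k * sqrt (f y * f x)).
{ rewrite <- sqrt_mult by nra.
  replace (g y * g x * (m x * m y)) with (k ^ 2 * (f y * f x)).
  - rewrite sqrt_mult, sqrt_pow2; [ring | lra | apply pow2_ge_0 | nra].
  - pose proof (D x); pose proof (D y).
    replace (g y * g x * (m x * m y)) with ((g x * m x) * (g y * m y)) by ring.
    rewrite (D x), (D y); ring. }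
assert (0 < sqrt (m x * m y)) by (apply sqrt_lt_R0; nra).
apply (Rmult_eq_reg_r (sqrt (m x * m y) * k)); [| nra].
transitivity (k * (sqrt (g y * g x) * sqrt (m x * m y)) / sin (PI * (G y - G x)));
  [field; lra|].
rewrite Q.
apply (Rmult_eq_reg_r (sin (PI * (G y - G x)) * sin (PI * (F y - F x)))); [| nra].
transitivity (k * sqrt (f y * f x) * (k * sin (PI * (F y - F x)))); [field; lra|].
rewrite <- Sxy; field; lra.
Qed.

(** Needed because [Hol] quantifies over all representatives of an orbit. *)
Lemma PSL_cross_ratio (phi chi : Diff1) (psi : circle -> circle) :
  PSL2R psi -> (forall t, chi t = psi (phi t)) ->
  forall s t, s <> t -> cross_ratio chi s t = cross_ratio phi s t.
Proof.
intros Hpsi E s t H.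
destruct (cproj_cover s t H) as [x [y [-> [-> Hxy]]]].
destruct (diff_lift phi) as [F [_ [LF HF]]]; destruct (diff_lift chi) as [G [_ [LG HG]]].
rewrite (cross_ratio_lift phi F), (cross_ratio_lift chi G) by assumption.
unfold Rdiv; rewrite !Rmult_assoc; f_equal.
apply (PSL2R_lift psi F _ G _ Hpsi HF HG); trivial.
intro z; now rewrite <- LF, <- LG, E.
Qed.

(** * Elementary inequalities *)

Lemma Rpower_pos (x a : R) : 0 < Rpower x a.
Proof. apply exp_pos. Qed.

Lemma Rpower_le_1 (x a : R) : 0 < x <= 1 -> 0 <= a -> Rpower x a <= 1.
Proof.
intros Hx Ha; replace 1 with (Rpower 1 a) by (unfold Rpower; rewrite ln_1, Rmult_0_r; apply exp_0).
now apply Rle_Rpower_l.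
Qed.

Lemma Rpower_ge_self (x a : R) : 0 < x <= 1 -> a <= 1 -> x <= Rpower x a.
Proof.
intros Hx Ha; rewrite <- (Rpower_1 x) at 1 by lra.
replace 1 with (a + (1 - a)) by ring; rewrite Rpower_plus.
pose proof (Rpower_le_1 x (1 - a) Hx ltac:(lra)).
pose proof (Rpower_pos x a); nra.
Qed.

Lemma Rpower_minus_1 (x a : R) : 0 < x -> Rpower x (a - 1) = Rpower x a / x.
Proof.
intro Hx; unfold Rminus; rewrite Rpower_plus, Rpower_Ropp, Rpower_1; trivial.
Qed.

(** Convexity of [exp]: the tangent inequality at [c * x], taken at the endpoints [c] and 0 ([E1],
    [E2]), is averaged with weights [x] and [1 - x]. *)
Lemma exp_mul_le (c x : R) : 0 <= x <= 1 -> exp (c * x) - 1 <= x * (exp c - 1).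
Proof.
intro Hx; pose proof (exp_pos (c * x)).
assert (E1 : exp (c * x) * (1 + c * (1 - x)) <= exp c).
{ replace (exp c) with (exp (c * x) * exp (c * (1 - x)))
    by (rewrite <- exp_plus; f_equal; ring).
  pose proof (exp_ineq1_le (c * (1 - x))); nra. }
assert (E2 : exp (c * x) * (1 - c * x) <= 1).
{ assert (E : exp (c * x) * exp (- (c * x)) = 1)
    by (rewrite <- exp_plus, Rplus_opp_r; apply exp_0).
  pose proof (exp_ineq1_le (- (c * x))); nra. }
nra.
Qed.

Lemma exp_le (x y : R) : x <= y -> exp x <= exp y.
Proof. intros [H | ->]; [left; now apply exp_increasing | lra]. Qed.

Lemma Rabs_exp_minus_1 (u e : R) : Rabs u <= e -> Rabs (exp u - 1) <= exp e - 1.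
Proof.
intro H; apply Rabs_le_between in H.
pose proof (exp_le u e ltac:(lra)); pose proof (exp_le (- e) u ltac:(lra)).
assert (exp (- e) * exp e = 1).
{ rewrite <- exp_plus, <- exp_0; f_equal; ring. }
apply Rabs_le; split; [|lra].
pose proof (exp_pos (- e)); pose proof (exp_ineq1_le e); nra.
Qed.

(** The numerator of minus the derivative of [sin v / v]. Its own derivative, [u * sin u], lies
    between 0 and [u ^ 2]. *)
Lemma sin_minus_mul_cos_bounds (v : R) :
  0 < v <= PI -> 0 <= sin v - v * cos v <= v ^ 3.
Proof.
intro Hv.
destruct (MVT_cor2 (fun u => sin u - u * cos u) (fun u => u * sin u) 0 v) as [c [E Hc]].
- lra.
- intros c _; apply is_derive_Reals; auto_derive; [trivial | ring].
- rewrite sin_0 in E.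
  pose proof (sin_ge_0 c ltac:(lra) ltac:(lra)); pose proof (sin_lt_x c ltac:(lra)).
  replace (sin v - v * cos v) with (c * sin c * v) by lra.
  split; [repeat apply Rmult_le_pos; lra|].
  replace (v ^ 3) with (v * v * v) by ring.
  apply Rmult_le_compat_r; [lra|]; apply Rmult_le_compat; lra.
Qed.

(** Mean value theorem for [sin (PI * u) / u]; the constant is [4 ^ 3], which dominates [PI ^ 3]. *)
Lemma sin_PI_div_decrease (u v : R) :
  0 < u <= v -> v <= 1 ->
  0 <= sin (PI * u) / u - sin (PI * v) / v <= 64 * (v - u).
Proof.
intros [Hu [Huv | <-]] Hv; [|lra].
destruct (MVT_cor2 (fun u => sin (PI * u) / u)
  (fun u => (PI * u * cos (PI * u) - sin (PI * u)) / u ^ 2) u v Huv) as [c [E Hc]].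
{ intros c Hc; apply is_derive_Reals; auto_derive; [lra | field; lra]. }
pose proof PI_RGT_0; pose proof PI_4.
pose proof (sin_minus_mul_cos_bounds (PI * c) ltac:(nra)) as [B1 B2].
assert (B : 0 <= (sin (PI * c) - PI * c * cos (PI * c)) / c ^ 2 <= 64).
{ split.
  - apply Rle_div_r; [nra | lra].
  - apply Rle_div_l; [nra|].
    apply (Rle_trans _ _ _ B2).
    replace ((PI * c) ^ 3) with (PI * PI * PI * c * c ^ 2) by ring.
    apply Rmult_le_compat_r; [nra|].
    replace 64 with (4 * 4 * 4 * 1) by ring.
    repeat (apply Rmult_le_compat; try nra). }
replace (sin (PI * u) / u - sin (PI * v) / v)
  with ((sin (PI * c) - PI * c * cos (PI * c)) / c ^ 2 * (v - u)).
- split; nra.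
- transitivity (- (sin (PI * v) / v - sin (PI * u) / u)); [rewrite E; field; lra | ring].
Qed.

(** The decreasing quotient [sin (PI * u) / u] equals 2 at [u = 1 / 2]. *)
Lemma jordan_PI (u : R) : 0 <= u <= 1 / 2 -> 2 * u <= sin (PI * u).
Proof.
intros [[H | <-] Hu]; [|rewrite !Rmult_0_r, sin_0; lra].
pose proof (sin_PI_div_decrease u (1 / 2) ltac:(lra) ltac:(lra)) as [B _].
replace (PI * (1 / 2)) with (PI / 2) in B by field; rewrite sin_PI2 in B.
assert (E : 2 <= sin (PI * u) / u) by lra.
apply Rle_div_r in E; lra.
Qed.

Lemma sin_PI_compl (u : R) : sin (PI * (1 - u)) = sin (PI * u).
Proof. replace (PI * (1 - u)) with (PI - PI * u) by ring; apply sin_PI_x. Qed.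

(** * Direct part *)

Definition cross_ratio_near (K a : R) (F f : R -> R) (x y : R) : Prop :=
  Rabs (PI * sqrt (f y * f x) / sin (PI * (F y - F x)) - PI / sin (PI * (y - x)))
    <= K * Rpower (Rmin (y - x) (1 - (y - x))) (a - 1).

Definition log_holder (K a : R) (f : R -> R) (x y : R) : Prop :=
  Rabs (ln (f y) - ln (f x)) < K * Rpower (Rmin (y - x) (1 - (y - x))) a.

(** Passing to the complementary arc replaces a length [u] by [1 - u], in the source and in the
    image, which changes neither the sines nor the minimum. Only arcs of length at most [1 / 2]
    remain to be treated. *)
Lemma cross_ratio_near_swap (K a : R) (F f : R -> R) (x y : R) :
  circle_lift F f -> cross_ratio_near K a F f y (x + 1) -> cross_ratio_near K a F f x y.
Proof.
intros [_ _ Hp Hq]; unfold cross_ratio_near; rewrite Hp, Hq.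
replace (F x + 1 - F y) with (1 - (F y - F x)) by ring.
replace (x + 1 - y) with (1 - (y - x)) by ring.
rewrite !sin_PI_compl, Rmin_comm, (Rmult_comm (f x)).
now replace (1 - (1 - (y - x))) with (y - x) by ring.
Qed.

(** Over a period [F] increases by 1, so [f] equals 1 at some [c]; the oscillation of [ln f] from
    [c] is at most [C] because circle distances are below 1. *)
Lemma log_deriv_bound (a C x z : R) (F f : R -> R) :
  0 < a -> 0 < C -> circle_lift F f ->
  (forall x y, x < y < x + 1 -> log_holder C a f x y) ->
  x <= z <= x + 1 -> exp (- C) <= f z <= exp C.
Proof.
intros Ha HC HF H Hz.
destruct (MVT_cor2 F f x (x + 1)) as [c [Ec Hc]]; [lra| |].
{ intros; apply is_derive_Reals, (lift_derive _ _ HF). }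
rewrite (lift_period _ _ HF) in Ec.
assert (fc : f c = 1) by lra.
assert (B : Rabs (ln (f z)) <= C).
{ destruct (Rtotal_order c z) as [L | [L | L]].
  - pose proof (H c z ltac:(lra)) as B; unfold log_holder in B.
    rewrite fc, ln_1, Rminus_0_r in B.
    pose proof (Rpower_le_1 (Rmin (z - c) (1 - (z - c))) a) as P.
    unfold Rmin in *; destruct Rle_dec; specialize (P ltac:(lra) ltac:(lra)); nra.
  - rewrite <- L, fc, ln_1, Rabs_R0; lra.
  - pose proof (H z c ltac:(lra)) as B; unfold log_holder in B.
    rewrite fc, ln_1, Rminus_0_l, Rabs_Ropp in B.
    pose proof (Rpower_le_1 (Rmin (c - z) (1 - (c - z))) a) as P.
    unfold Rmin in *; destruct Rle_dec; specialize (P ltac:(lra) ltac:(lra)); nra. }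
apply Rabs_le_between in B.
rewrite <- (exp_ln (f z)) by apply (lift_pos _ _ HF).
split; apply exp_le; lra.
Qed.

(** The image arc is [D = f xi * d]. The error splits into the deviation of [r], the ratio of the
    geometric mean of [f] to [f xi], from 1, and the variation of [S] between [d] and [D]. *)
Lemma log_holder_cross_ratio_short (a C x y : R) (F f : R -> R) :
  0 < a < 1 -> 0 < C -> circle_lift F f ->
  (forall x y, x < y < x + 1 -> log_holder C a f x y) ->
  x < y <= x + 1 / 2 ->
  cross_ratio_near (132 * (exp C * (exp C - 1))) a F f x y.
Proof.
intros Ha HC HF H Hxy.
unfold cross_ratio_near; rewrite Rmin_left, Rpower_minus_1 by lra.
set (d := y - x); set (D := F y - F x); set (p := Rpower d a).
assert (Hd : 0 < d <= 1 / 2) by (unfold d; lra).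
pose proof (exp_ineq1_le C) as EC.
assert (Hp : d <= p <= 1).
{ split; [apply Rpower_ge_self | apply Rpower_le_1]; lra. }
pose proof (lift_pos _ _ HF) as Hf.
destruct (MVT_cor2 F f x y) as [xi [Exi Hxi]]; [lra| |].
{ intros; apply is_derive_Reals, (lift_derive _ _ HF). }
destruct (MVT_cor2 F f y (x + 1)) as [et [Eet Het]]; [lra| |].
{ intros; apply is_derive_Reals, (lift_derive _ _ HF). }
rewrite (lift_period _ _ HF) in Eet.
fold d D in Exi.
replace (F x + 1 - F y) with (1 - D) in Eet by (unfold D; ring).
replace (x + 1 - y) with (1 - d) in Eet by (unfold d; ring).
pose proof (log_deriv_bound a C x xi F f ltac:(lra) HC HF H ltac:(lra)) as Bxi.
pose proof (log_deriv_bound a C x et F f ltac:(lra) HC HF H ltac:(lra)) as Bet.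
pose proof (exp_pos (- C)).
assert (EE : exp (- C) * exp C = 1).
{ rewrite <- exp_plus, <- exp_0; f_equal; ring. }
pose proof (lift_increment _ _ x y HF ltac:(lra)) as HD; fold D in HD.
set (S := fun u => sin (PI * u) / u).
assert (Sd : 2 <= S d).
{ unfold S; apply Rle_div_r; [lra | apply jordan_PI; lra]. }
(* When [D] exceeds [1 / 2] the sine is bounded through the complementary image arc, of length
   [f et * (1 - d)], hence at least [exp (- C) / 2]. *)
assert (SD : exp (- C) <= S D).
{ unfold S; apply Rle_div_r; [lra|].
  assert (exp (- C) <= 1) by nra.
  destruct (Rle_dec D (1 / 2)).
  - pose proof (jordan_PI D ltac:(lra)); nra.
  - pose proof (jordan_PI (1 - D) ltac:(lra)) as J.
    rewrite sin_PI_compl in J.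
    assert (exp (- C) * (1 / 2) <= f et * (1 - d)) by (apply Rmult_le_compat; lra).
    nra. }
assert (SS : Rabs (S d - S D) <= 64 * (d * (exp C - 1))).
{ assert (Rabs (D - d) <= d * (exp C - 1)).
  { replace (D - d) with (d * (f xi - 1)) by (rewrite Exi; ring).
    rewrite Rabs_mult, (Rabs_pos_eq d) by lra.
    apply Rmult_le_compat_l; [lra|].
    apply Rabs_le; nra. }
  destruct (Rle_dec d D).
  - pose proof (sin_PI_div_decrease d D ltac:(lra) ltac:(lra)).
    rewrite Rabs_pos_eq in * by (unfold S; lra); unfold S; lra.
  - pose proof (sin_PI_div_decrease D d ltac:(lra) ltac:(lra)).
    rewrite Rabs_left1 in * by (unfold S; lra); unfold S; lra. }
set (r := sqrt (f y * f x) / f xi).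
assert (Hr : Rabs (r - 1) <= p * (exp C - 1)).
{ apply Rle_trans with (exp (C * p) - 1); [| apply exp_mul_le; lra].
  (* The exponent is the mean of two increments of [ln f], each at most [C * p] in absolute value
     because [xi] lies between [x] and [y]. *)
  replace r with (exp ((ln (f y) + ln (f x)) / 2 - ln (f xi))).
  - apply Rabs_exp_minus_1.
    assert (B : forall u v, x <= u < v -> v <= y -> Rabs (ln (f v) - ln (f u)) <= C * p).
    { intros u v Hu Hv.
      pose proof (H u v ltac:(lra)) as B; unfold log_holder in B.
      rewrite Rmin_left in B by lra.
      pose proof (Rle_Rpower_l (v - u) d a ltac:(lra) ltac:(unfold d; lra)) as Bp.
      fold p in Bp; nra. }
    pose proof (B x xi ltac:(lra) ltac:(lra)) as B1.
    pose proof (B xi y ltac:(lra) ltac:(lra)) as B2.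
    apply Rabs_le_between in B1; apply Rabs_le_between in B2.
    apply Rabs_le; lra.
  - unfold Rminus, r, Rdiv; rewrite exp_plus, exp_Ropp, exp_ln by trivial.
    f_equal; rewrite <- ln_mult by trivial.
    symmetry; apply sqrt_lem_1.
    + pose proof (Hf x); pose proof (Hf y); nra.
    + apply Rlt_le, exp_pos.
    + rewrite <- exp_plus.
      replace (_ * / 2 + _) with (ln (f y * f x)) by field.
      apply exp_ln, Rmult_lt_0_compat; trivial. }
assert (SDp : 0 < S D) by lra.
pose proof (sin_PI_pos D HD); pose proof (sin_PI_pos d ltac:(lra)); pose proof (Hf xi).
replace (PI * sqrt (f y * f x) / sin (PI * D) - PI / sin (PI * d))
  with (PI / d * ((r - 1) / S D + (S d - S D) / (S D * S d))).
2:{ assert (Er : sqrt (f y * f x) = r * (D / d)) by (unfold r; rewrite Exi; field; lra).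
    rewrite Er; unfold S; field; lra. }
pose proof PI_RGT_0; pose proof PI_4.
assert (iS : / S D <= exp C).
{ apply (Rmult_le_reg_l (S D)); [lra|]; rewrite Rinv_r by lra; nra. }
assert (iS' : / (S D * S d) <= exp C * / 2).
{ rewrite Rinv_mult; apply Rmult_le_compat; try (left; apply Rinv_0_lt_compat; lra); trivial.
  apply Rinv_le_contravar; lra. }
assert (0 < / d) by (apply Rinv_0_lt_compat; lra).
rewrite Rabs_mult, (Rabs_pos_eq (PI / d)) by (unfold Rdiv; nra).
(* The constant is [4 * (1 + 32)]: 4 bounds [PI], 1 comes from [r - 1], and 32 is the 64 of the
   variation of [S] divided by [S d >= 2]. *)
replace (132 * (exp C * (exp C - 1)) * (p / d))
  with (4 / d * (p * (exp C - 1) * exp C + 32 * (p * (exp C - 1)) * exp C)) by (field; lra).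
apply Rmult_le_compat; try apply Rabs_pos.
- unfold Rdiv; nra.
- unfold Rdiv; nra.
- apply (Rle_trans _ _ _ (Rabs_triang _ _)); unfold Rdiv.
  rewrite !Rabs_mult.
  assert (0 < / (S D * S d)) by (apply Rinv_0_lt_compat; nra).
  assert (0 < / S D) by (apply Rinv_0_lt_compat; lra).
  rewrite (Rabs_pos_eq (/ S D)), (Rabs_pos_eq (/ (S D * S d))) by lra.
  apply Rplus_le_compat.
  + apply Rmult_le_compat; try apply Rabs_pos; lra.
  + replace (32 * (p * (exp C - 1)) * exp C) with (64 * (p * (exp C - 1)) * (exp C * / 2)) by field.
    apply Rmult_le_compat; try apply Rabs_pos; nra.
Qed.

Lemma direct_part (a C : R) (phi : Diff1) :
  0 < a < 1 -> 0 < C -> log_deriv_holder a C phi ->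
  Hol a (132 * (exp C * (exp C - 1))) (PSL_class phi).
Proof.
intros Ha HC H chi [psi [Hpsi E]] s t Hst.
unfold cross_ratio_bound; rewrite (PSL_cross_ratio phi chi psi Hpsi E s t Hst).
destruct (diff_lift phi) as [F [_ [L HF]]].
destruct (cproj_cover s t Hst) as [x [y [-> [-> Hxy]]]].
rewrite (cross_ratio_lift phi F x y L HF Hxy), cdist_cproj, arc_cproj by lra.
assert (Hl : forall x y, x < y < x + 1 ->
   log_holder C a (fun x => cderive phi (cproj x)) x y).
{ intros u v Huv; unfold log_holder; rewrite <- cdist_cproj by lra.
  now apply H, cproj_neq. }
set (f := fun x => cderive phi (cproj x)) in *.
change (cross_ratio_near (132 * (exp C * (exp C - 1))) a F f x y).
destruct (Rle_dec y (x + 1 / 2)).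
- apply log_holder_cross_ratio_short; trivial; lra.
- apply cross_ratio_near_swap; trivial.
  apply log_holder_cross_ratio_short; trivial; lra.
Qed.

(** * The planar frame of a lift *)

(** An increment over [h] is half the increment over [2 * h] minus half a second difference. The
    bound [L] therefore passes from scale [2 * h] to [h] as soon as [L * 2^a + A <= 2 * L], which is
    solvable because [a < 1]. Scales above [r] are covered by the sup bound [B]. *)
Lemma zygmund_holder (a A B r : R) (V : R -> R) :
  0 < a < 1 -> 0 <= A -> 0 < r ->
  (forall x, Rabs (V x) <= B) ->
  (forall x h, 0 < h <= r -> Rabs (V (x + h) + V (x - h) - 2 * V x) <= A * Rpower h a) ->
  forall x h, 0 < h ->
  Rabs (V (x + h) - V x) <= (A / (2 - Rpower 2 a) + 2 * B * Rpower (/ r) a) * Rpower h a.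
Proof.
intros Ha HA Hr HB HV.
assert (B0 : 0 <= B) by (apply Rle_trans with (2 := HB 0), Rabs_pos).
assert (P2 : Rpower 2 a < 2).
{ rewrite <- (Rpower_1 2) at 2 by lra; apply Rpower_lt; lra. }
set (L := A / (2 - Rpower 2 a) + 2 * B * Rpower (/ r) a).
pose proof (Rpower_pos (/ r) a) as Pr.
assert (HL : 2 * B * Rpower (/ r) a <= L).
{ unfold L; assert (0 <= A / (2 - Rpower 2 a)) by (apply Rdiv_le_0_compat; lra); lra. }
assert (HL' : L * Rpower 2 a + A <= 2 * L).
{ assert (A = A / (2 - Rpower 2 a) * (2 - Rpower 2 a)) by (field; lra).
  assert (0 <= 2 * B * Rpower (/ r) a * (2 - Rpower 2 a)) by (repeat apply Rmult_le_pos; lra).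
  unfold L; lra. }
assert (Hbig : forall x h, r <= h -> Rabs (V (x + h) - V x) <= L * Rpower h a).
{ intros x h Hh.
  assert (1 <= Rpower (/ r) a * Rpower h a).
  { rewrite Rpower_mult_distr; [| now apply Rinv_0_lt_compat | lra].
    replace 1 with (Rpower 1 a) by (unfold Rpower; rewrite ln_1, Rmult_0_r; apply exp_0).
    apply Rle_Rpower_l; [lra | split; [lra|]].
    apply (Rmult_le_reg_l r); [lra|]; rewrite <- Rmult_assoc, Rinv_r; lra. }
  pose proof (HB x) as B1; pose proof (HB (x + h)) as B2.
  apply Rabs_le_between in B1; apply Rabs_le_between in B2.
  pose proof (Rpower_pos h a).
  apply Rle_trans with (2 * B); [apply Rabs_le; lra | nra]. }
(* Here [n] counts the doublings that bring [h] up to the scale [r]. *)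
assert (Hn : forall n x h, 0 < h -> r <= 2 ^ n * h ->
  Rabs (V (x + h) - V x) <= L * Rpower h a).
{ induction n as [|n IH]; intros x h Hh Hr'; [apply Hbig; simpl in Hr'; lra|].
  destruct (Rle_dec r h) as [|Hrh]; [now apply Hbig|].
  pose proof (IH x (2 * h) ltac:(lra) ltac:(simpl in Hr'; lra)) as I.
  rewrite <- Rpower_mult_distr in I by lra.
  pose proof (HV (x + h) h ltac:(lra)) as Z.
  replace (x + h - h) with x in Z by ring.
  replace (x + h + h) with (x + 2 * h) in Z by ring.
  apply Rabs_le_between in I; apply Rabs_le_between in Z.
  pose proof (Rpower_pos h a); apply Rabs_le; nra. }
intros x h Hh.
destruct (Pow_x_infinity 2 ltac:(rewrite Rabs_pos_eq; lra) (r / h)) as [n Hn'].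
apply (Hn n); trivial.
specialize (Hn' n (le_n n)); rewrite Rabs_pos_eq in Hn' by (apply pow_le; lra).
apply Rge_le, Rle_div_l in Hn'; lra.
Qed.

Definition frame1 (F f : R -> R) (x : R) : R := cos (PI * F x) / sqrt (f x).
Definition frame2 (F f : R -> R) (x : R) : R := sin (PI * F x) / sqrt (f x).

Definition wedge (F f : R -> R) (x y : R) : R :=
  frame1 F f x * frame2 F f y - frame2 F f x * frame1 F f y.

Lemma wedge_sin (F f : R -> R) (x y : R) :
  circle_lift F f ->
  wedge F f x y = sin (PI * (F y - F x)) / (sqrt (f x) * sqrt (f y)).
Proof.
intro HF; unfold wedge, frame1, frame2.
pose proof (sqrt_lt_R0 _ (lift_pos _ _ HF x)); pose proof (sqrt_lt_R0 _ (lift_pos _ _ HF y)).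
rewrite Rmult_minus_distr_l, sin_minus; field; lra.
Qed.

Lemma wedge_pos (F f : R -> R) (x y : R) :
  circle_lift F f -> x < y < x + 1 -> 0 < wedge F f x y.
Proof.
intros HF H; rewrite wedge_sin by trivial.
pose proof (sqrt_lt_R0 _ (lift_pos _ _ HF x)); pose proof (sqrt_lt_R0 _ (lift_pos _ _ HF y)).
apply Rdiv_lt_0_compat; [apply sin_PI_pos, (lift_increment F f); trivial | nra].
Qed.

Lemma wedge_nonneg (F f : R -> R) (x y : R) :
  circle_lift F f -> x <= y <= x + 1 -> 0 <= wedge F f x y.
Proof.
intros HF H.
destruct (Req_dec x y) as [<- | N1]; [unfold wedge; lra|].
destruct (Req_dec y (x + 1)) as [-> | N2].
- rewrite wedge_sin, (lift_period _ _ HF) by trivial.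
  replace (PI * (F x + 1 - F x)) with PI by ring.
  rewrite sin_PI; unfold Rdiv; rewrite Rmult_0_l; lra.
- left; apply wedge_pos; trivial; lra.
Qed.

(* With the cross ratio written as [PI / wedge], the bound on the cross ratio
   turns into a multiplicative one on the wedge. *)
Lemma wedge_near_sin (a K : R) (F f : R -> R) (x y : R) :
  circle_lift F f -> x < y < x + 1 ->
  let m := Rmin (y - x) (1 - (y - x)) in
  0 < K -> K * Rpower m a <= 1 / 2 ->
  cross_ratio_near K a F f x y ->
  2 / 3 * sin (PI * (y - x)) <= wedge F f x y <= 2 * sin (PI * (y - x)) /\
  Rabs (wedge F f x y - sin (PI * (y - x))) <= 8 * K * (m * Rpower m a).
Proof.
intros HF Hxy m HK Hm Hn.
pose proof (wedge_pos F f x y HF Hxy) as Hw.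
set (w := wedge F f x y) in *; set (s := sin (PI * (y - x))).
assert (Hs : 0 < s) by (apply sin_PI_pos; lra).
assert (m0 : 0 < m) by (unfold m, Rmin; destruct Rle_dec; lra).
pose proof PI_RGT_0; pose proof PI_4.
assert (sm : s <= PI * m).
{ assert (forall u, 0 < u -> sin (PI * u) < PI * u) by (intros u Hu; apply sin_lt_x; nra).
  unfold m, Rmin, s; destruct Rle_dec; [left; apply H1; lra|].
  rewrite <- sin_PI_compl; left; apply H1; lra. }
unfold cross_ratio_near in Hn; fold m s in Hn.
assert (Ew : PI * sqrt (f y * f x) / sin (PI * (F y - F x)) = PI / w).
{ unfold w; rewrite wedge_sin by trivial.
  pose proof (lift_pos _ _ HF x); pose proof (lift_pos _ _ HF y).
  pose proof (sqrt_lt_R0 _ (lift_pos _ _ HF x)); pose proof (sqrt_lt_R0 _ (lift_pos _ _ HF y)).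
  pose proof (sin_PI_pos _ (lift_increment _ _ x y HF Hxy)).
  rewrite sqrt_mult by lra; field; lra. }
rewrite Ew, Rpower_minus_1 in Hn by trivial.
replace (PI / w - PI / s) with (PI / (w * s) * (s - w)) in Hn by (field; lra).
rewrite Rabs_mult, Rabs_pos_eq in Hn by (apply Rlt_le, Rdiv_lt_0_compat; nra).
set (p := Rpower m a) in *; assert (p0 : 0 < p) by apply Rpower_pos.
(* The factor [PI / (w * s)] is cleared with [PI / s >= 1 / m]. Since [K * p <= 1 / 2], this
   relative bound yields [2 / 3 * s <= w <= 2 * s]; reinserting [w <= 2 * s] and [s <= 4 * m]
   produces the factor 8. *)
assert (B : Rabs (s - w) <= K * p * w).
{ apply (Rmult_le_reg_l (PI / (w * s))); [apply Rdiv_lt_0_compat; nra|].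
  apply (Rle_trans _ _ _ Hn).
  replace (PI / (w * s) * (K * p * w)) with (K * p * (PI / s)) by (field; lra).
  replace (K * (p / m)) with (K * p * / m) by (field; lra).
  apply Rmult_le_compat_l; [nra|].
  apply Rle_div_r; [trivial|].
  apply (Rmult_le_reg_l m); [trivial|]; rewrite <- Rmult_assoc, Rinv_r; lra. }
assert (B' := B); apply Rabs_le_between in B'.
assert (K * p * w <= 1 / 2 * w) by nra.
split; [split; lra|].
rewrite Rabs_minus_sym; apply (Rle_trans _ _ _ B).
apply Rle_trans with (K * p * (2 * (4 * m))); [| right; ring].
apply Rmult_le_compat_l; nra.
Qed.

Lemma cos_sin_lipschitz (x y : R) :
  x < y -> Rabs (cos (PI * y) - cos (PI * x)) <= 4 * (y - x) /\
           Rabs (sin (PI * y) - sin (PI * x)) <= 4 * (y - x).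
Proof.
intro H; pose proof PI_RGT_0; pose proof PI_4.
assert (B : forall b, -1 <= b <= 1 -> - (4 * (y - x)) <= PI * b * (y - x) <= 4 * (y - x)).
{ intros b Hb; assert (-4 <= PI * b <= 4) by nra; nra. }
split.
- destruct (MVT_cor2 (fun u => cos (PI * u)) (fun u => - (PI * sin (PI * u))) x y H) as [c [-> _]].
  { intros; apply is_derive_Reals; auto_derive; [trivial | ring]. }
  pose proof (B _ (SIN_bound (PI * c))); apply Rabs_le; lra.
- destruct (MVT_cor2 (fun u => sin (PI * u)) (fun u => PI * cos (PI * u)) x y H) as [c [-> _]].
  { intros; apply is_derive_Reals; auto_derive; [trivial | ring]. }
  pose proof (B _ (COS_bound (PI * c))); apply Rabs_le; lra.
Qed.

(** The constant of [zygmund_holder] at scale [r / 2], with [A := 3 * (1 + B) * E + 16 * B]. *)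
Definition frame_holder_const (a r E B : R) : R :=
  (3 * (1 + B) * E + 16 * B) / (2 - Rpower 2 a) + 2 * B * Rpower (/ (r / 2)) a.

(* Three vectors of the plane satisfy a Pluecker relation; when they are values of
   the frame at equally spaced points it bounds a second difference. *)
Lemma frame_second_difference (a r E B : R) (F f u c : R -> R) :
  0 < a < 1 -> 0 < r <= 1 / 2 -> 0 <= E ->
  (forall x y, x < y <= x + r ->
     Rabs (wedge F f x y - sin (PI * (y - x))) <= E * ((y - x) * Rpower (y - x) a)) ->
  (forall x y z, wedge F f y z * u x + wedge F f x y * u z = wedge F f x z * u y) ->
  (forall x h, c (x + h) + c (x - h) = 2 * cos (PI * h) * c x) ->
  (forall x, Rabs (c x) <= 1) ->
  (forall x, Rabs (u x - c x) <= B) ->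
  forall x h, 0 < h ->
  Rabs ((u (x + h) - c (x + h)) - (u x - c x)) <= frame_holder_const a r E B * Rpower h a.
Proof.
intros Ha Hr HE HW Hu Hc Hc1 HB.
assert (B0 : 0 <= B) by (apply Rle_trans with (2 := HB 0), Rabs_pos).
(* The scale is [r / 2] because the outer points [x - h] and [x + h] are [2 * h] apart. *)
apply (zygmund_holder a (3 * (1 + B) * E + 16 * B) B (r / 2) (fun x => u x - c x));
  trivial; [nra | lra |].
intros x h Hh.
set (p := Rpower h a).
assert (Hp : h <= p) by (apply Rpower_ge_self; lra).
assert (Hp2 : Rpower (2 * h) a <= 2 * p).
{ rewrite <- Rpower_mult_distr by lra; fold p.
  apply Rmult_le_compat_r; [lra|].
  rewrite <- (Rpower_1 2) at 2 by lra; apply Rle_Rpower; lra. }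
pose proof (HW x (x + h) ltac:(lra)) as W1.
pose proof (HW (x - h) x ltac:(lra)) as W2.
pose proof (HW (x - h) (x + h) ltac:(lra)) as W3.
replace (x + h - x) with h in W1 by ring.
replace (x - (x - h)) with h in W2 by ring.
replace (x + h - (x - h)) with (2 * h) in W3 by ring.
replace (PI * (2 * h)) with (2 * (PI * h)) in W3 by ring; rewrite sin_2a in W3.
fold p in W1, W2.
pose proof (jordan_PI h ltac:(lra)) as J.
pose proof (Hu (x - h) x (x + h)) as T.
assert (Bu : forall y, Rabs (u y) <= 1 + B).
{ intro y; replace (u y) with (c y + (u y - c y)) by ring.
  apply (Rle_trans _ _ _ (Rabs_triang _ _)).
  pose proof (Hc1 y); pose proof (HB y); lra. }
set (s := sin (PI * h)) in *; set (k := cos (PI * h)) in *.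
(* With exact sines for wedges, [T] would make the left side vanish. The three wedge errors total at
   most [6 * E * h * p], of which 4 parts come from the outer pair; dividing by [s >= 2 * h] leaves
   the factor 3. *)
assert (X : Rabs (u (x + h) + u (x - h) - 2 * k * u x) <= 3 * (1 + B) * E * p).
{ apply (Rmult_le_reg_l (2 * h)); [lra|].
  apply Rle_trans with (Rabs (s * (u (x + h) + u (x - h) - 2 * k * u x))).
  { rewrite Rabs_mult, (Rabs_pos_eq s) by lra.
    apply Rmult_le_compat_r; [apply Rabs_pos | lra]. }
  set (w1 := wedge F f x (x + h)) in *; set (w2 := wedge F f (x - h) x) in *.
  set (w3 := wedge F f (x - h) (x + h)) in *.
  replace (s * (u (x + h) + u (x - h) - 2 * k * u x))
    with ((w3 - 2 * s * k) * u x - (w1 - s) * u (x - h) - (w2 - s) * u (x + h)) by lra.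
  assert (M : forall e b v, Rabs e <= b -> Rabs (e * u v) <= b * (1 + B)).
  { intros e b v He; rewrite Rabs_mult; apply Rmult_le_compat; auto using Rabs_pos. }
  pose proof (M _ _ x W3) as M3; pose proof (M _ _ (x - h) W1) as M1.
  pose proof (M _ _ (x + h) W2) as M2.
  assert (E * (2 * h * Rpower (2 * h) a) * (1 + B) <= E * (2 * h * (2 * p)) * (1 + B)).
  { apply Rmult_le_compat_r; [lra|]; apply Rmult_le_compat_l; [lra|].
    apply Rmult_le_compat_l; lra. }
  apply Rabs_le_between in M1; apply Rabs_le_between in M2; apply Rabs_le_between in M3.
  apply Rabs_le; lra. }
(* The model [c] satisfies its recurrence with [2 * k] in place of 2; this estimate pays for the
   replacement and gives the [16 * B]. *)
assert (Y : 0 <= 1 - k <= 8 * h).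
{ unfold k; replace (PI * h) with (2 * (PI * (h / 2))) by field.
  rewrite cos_2a_sin.
  pose proof PI_RGT_0; pose proof PI_4.
  pose proof (sin_lt_x (PI * (h / 2)) ltac:(nra)).
  pose proof (sin_PI_pos (h / 2) ltac:(lra)).
  assert (sin (PI * (h / 2)) <= 2 * h) by nra.
  nra. }
replace (u (x + h) - c (x + h) + (u (x - h) - c (x - h)) - 2 * (u x - c x))
  with ((u (x + h) + u (x - h) - 2 * k * u x) - 2 * (1 - k) * (u x - c x)).
2:{ pose proof (Hc x h) as Hcx; fold k in Hcx; lra. }
apply (Rle_trans _ _ _ (Rabs_triang _ _)); rewrite Rabs_Ropp, Rabs_mult.
rewrite (Rabs_pos_eq (2 * (1 - k))) by lra.
pose proof (HB x); pose proof (Rabs_pos (u x - c x)).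
assert (2 * (1 - k) * Rabs (u x - c x) <= 2 * (8 * p) * B) by (apply Rmult_le_compat; lra).
lra.
Qed.

Lemma frame_norm_sqr (F f : R -> R) (x : R) :
  0 < f x -> frame1 F f x ^ 2 + frame2 F f x ^ 2 = / f x.
Proof.
intro H; unfold frame1, frame2.
pose proof (sin2_cos2 (PI * F x)) as E; unfold Rsqr in E.
pose proof (sqrt_sqrt (f x) ltac:(lra)) as S; pose proof (sqrt_lt_R0 _ H).
rewrite <- S at 3.
replace (/ (sqrt (f x) * sqrt (f x))) with
  ((sin (PI * F x) * sin (PI * F x) + cos (PI * F x) * cos (PI * F x)) / (sqrt (f x) * sqrt (f x)))
  by (rewrite E; field; lra).
field; lra.
Qed.

Lemma ln_lipschitz (m p q : R) :
  0 < m -> m <= p -> m <= q -> Rabs (ln p - ln q) <= Rabs (p - q) / m.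
Proof.
intro Hm.
assert (H : forall u v, m <= u -> m <= v -> ln u - ln v <= Rabs (u - v) / m).
{ intros u v Hu Hv.
  apply Rle_trans with ((u - v) / v).
  - pose proof (exp_ineq1_le (ln u - ln v)) as X.
    unfold Rminus in X at 2; rewrite exp_plus, exp_Ropp, !exp_ln in X by lra.
    apply Rle_trans with (u * / v - 1); [lra | right; field; lra].
  - unfold Rdiv; apply Rle_trans with (Rabs (u - v) * / v).
    + apply Rmult_le_compat_r; [left; apply Rinv_0_lt_compat; lra | apply Rle_abs].
    + apply Rmult_le_compat_l; [apply Rabs_pos | apply Rinv_le_contravar; lra]. }
intros Hp Hq; pose proof (H p q Hp Hq); pose proof (H q p Hq Hp) as H2.
rewrite Rabs_minus_sym in H2; apply Rabs_le; lra.
Qed.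

(** The first factor is a Hoelder constant of [1 / f], the second the inverse of a lower bound of
    [1 / f]. *)
Definition log_holder_const (a r E B : R) : R :=
  (4 * frame_holder_const a r E B * (1 + B) + 16 * B) * (2 * (1 + B) ^ 2 / r ^ 2).

(** The squared length of the frame is [1 / f], and that of the model (cos, sin) is constant, so
    only the deviation contributes to the increment of [1 / f]. The logarithm is Lipschitz away from
    0, where the frame is kept by the wedge bound at distance [r]. *)
Lemma frame_log_holder (a r E B : R) (F f : R -> R) :
  0 < a < 1 -> 0 < r <= 1 / 2 -> 0 <= E -> circle_lift F f ->
  (forall x y, x < y <= x + r ->
     Rabs (wedge F f x y - sin (PI * (y - x))) <= E * ((y - x) * Rpower (y - x) a)) ->
  (forall x, r <= wedge F f x (x + r)) ->
  (forall x, Rabs (frame1 F f x - cos (PI * x)) <= B) ->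
  (forall x, Rabs (frame2 F f x - sin (PI * x)) <= B) ->
  forall x y, x < y <= x + 1 ->
  Rabs (ln (f y) - ln (f x)) <= log_holder_const a r E B * Rpower (y - x) a.
Proof.
intros Ha Hr HE HF HW Hlow B1 B2 x y Hxy.
assert (B0 : 0 <= B) by (apply Rle_trans with (2 := B1 0), Rabs_pos).
pose proof (lift_pos _ _ HF) as Hf.
set (L := frame_holder_const a r E B).
set (h := y - x); set (p := Rpower h a).
assert (Hp : h <= p) by (apply Rpower_ge_self; unfold h; lra).
assert (h0 : 0 < h) by (unfold h; lra).
(* One coordinate at a time, with [v = u - c]: the increment of [u ^ 2 - c ^ 2] is split so that
   each term contains either the increment of [v], which is Hoelder, or that of [c], which is
   Lipschitz. *)
assert (D : forall u c : R -> R,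
  (forall x y z, wedge F f y z * u x + wedge F f x y * u z = wedge F f x z * u y) ->
  (forall x h, c (x + h) + c (x - h) = 2 * cos (PI * h) * c x) ->
  (forall x, Rabs (c x) <= 1) ->
  (forall x, Rabs (u x - c x) <= B) ->
  Rabs (c y - c x) <= 4 * h ->
  Rabs (u y ^ 2 - c y ^ 2 - (u x ^ 2 - c x ^ 2)) <= (2 * L * (1 + B) + 8 * B) * p).
{ intros u c Hu Hc Hc1 HB Hl.
  pose proof (frame_second_difference a r E B F f u c Ha Hr HE HW Hu Hc Hc1 HB x h h0) as V.
  fold L p in V; replace (x + h) with y in V by (unfold h; ring).
  set (vy := u y - c y) in *; set (vx := u x - c x) in *.
  replace (u y ^ 2 - c y ^ 2 - (u x ^ 2 - c x ^ 2))
    with ((vy - vx) * (2 * c y + (vy + vx)) + 2 * ((c y - c x) * vx))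
    by (unfold vy, vx; ring).
  pose proof (HB x) as Hx; pose proof (HB y) as Hy; fold vx in Hx; fold vy in Hy.
  pose proof (Hc1 y) as Hcy.
  assert (S1 : Rabs (2 * c y + (vy + vx)) <= 2 * (1 + B)).
  { apply Rabs_le_between in Hx; apply Rabs_le_between in Hy; apply Rabs_le_between in Hcy.
    apply Rabs_le; lra. }
  apply (Rle_trans _ _ _ (Rabs_triang _ _)); rewrite !Rabs_mult, (Rabs_pos_eq 2) by lra.
  assert (Rabs (vy - vx) * Rabs (2 * c y + (vy + vx)) <= L * p * (2 * (1 + B)))
    by (apply Rmult_le_compat; trivial using Rabs_pos).
  assert (Rabs (c y - c x) * Rabs vx <= 4 * p * B)
    by (apply Rmult_le_compat; trivial using Rabs_pos; lra).
  lra. }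
destruct (cos_sin_lipschitz x y ltac:(lra)) as [Lc Ls].
pose proof (D (frame1 F f) (fun x => cos (PI * x))) as D1.
pose proof (D (frame2 F f) (fun x => sin (PI * x))) as D2.
cbv beta in D1, D2.
specialize (D1 ltac:(intros; unfold wedge; ring)).
specialize (D2 ltac:(intros; unfold wedge; ring)).
specialize (D1 ltac:(intros; rewrite Rmult_plus_distr_l, Rmult_minus_distr_l,
  cos_plus, cos_minus; ring)).
specialize (D2 ltac:(intros; rewrite Rmult_plus_distr_l, Rmult_minus_distr_l,
  sin_plus, sin_minus; ring)).
specialize (D1 ltac:(intros; apply Rabs_le, COS_bound) B1 Lc).
specialize (D2 ltac:(intros; apply Rabs_le, SIN_bound) B2 Ls).
assert (Q : Rabs (/ f y - / f x) <= (4 * L * (1 + B) + 16 * B) * p).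
{ rewrite <- !(frame_norm_sqr F f) by trivial.
  pose proof (sin2_cos2 (PI * x)) as Ex; pose proof (sin2_cos2 (PI * y)) as Ey.
  unfold Rsqr in Ex, Ey.
  apply Rabs_le_between in D1; apply Rabs_le_between in D2.
  apply Rabs_le; simpl in *; lra. }
assert (U : forall z, frame1 F f z ^ 2 <= (1 + B) ^ 2 /\ frame2 F f z ^ 2 <= (1 + B) ^ 2).
{ assert (H : forall u c, Rabs c <= 1 -> Rabs (u - c) <= B -> u ^ 2 <= (1 + B) ^ 2).
  { intros u c Hc Hu; apply Rabs_le_between in Hc; apply Rabs_le_between in Hu.
    assert (Rabs u <= 1 + B) by (apply Rabs_le; lra).
    rewrite <- (pow2_abs u).
    apply pow_incr; split; [apply Rabs_pos | trivial]. }
  intro z; split; [apply (H _ (cos (PI * z))) | apply (H _ (sin (PI * z)))]; trivial;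
    apply Rabs_le; [apply COS_bound | apply SIN_bound]. }
set (M := 2 * (1 + B) ^ 2) in *.
assert (M0 : 0 < M) by (unfold M; assert (0 < (1 + B) ^ 2) by (apply pow_lt; lra); lra).
(* Cauchy-Schwarz: the wedge of two vectors is at most the product of their lengths, and [M] bounds
   every squared length. *)
assert (low : forall z, r ^ 2 / M <= / f z).
{ intro z; apply Rle_div_l; [trivial|].
  apply Rle_trans with (/ f z * / f (z + r)).
  - rewrite <- !(frame_norm_sqr F f) by trivial.
    pose proof (Hlow z) as W.
    apply Rle_trans with (wedge F f z (z + r) ^ 2); [apply pow_incr; lra|].
    unfold wedge.
    set (a1 := frame1 F f z); set (a2 := frame2 F f z).
    set (b1 := frame1 F f (z + r)); set (b2 := frame2 F f (z + r)).
    pose proof (pow2_ge_0 (a1 * b1 + a2 * b2)); nra.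
  - apply Rmult_le_compat_l; [left; apply Rinv_0_lt_compat; trivial|].
    rewrite <- (frame_norm_sqr F f) by trivial.
    destruct (U (z + r)); unfold M; lra. }
assert (r0 : 0 < r ^ 2) by (apply pow_lt; lra).
replace (ln (f y) - ln (f x)) with (- (ln (/ f y) - ln (/ f x)))
  by (rewrite !ln_Rinv by trivial; ring).
rewrite Rabs_Ropp.
apply (Rle_trans _ _ _ (ln_lipschitz (r ^ 2 / M) _ _
  ltac:(now apply Rdiv_lt_0_compat) (low y) (low x))).
unfold log_holder_const; fold L p.
apply Rle_div_l; [now apply Rdiv_lt_0_compat|].
apply (Rle_trans _ _ _ Q); right; fold M; field; lra.
Qed.

(** * Bounds on the frame *)

Lemma sin_PI_third : 17 / 20 <= sin (PI * (1 / 3)) <= 1.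
Proof.
split; [| apply SIN_bound].
replace (PI * (1 / 3)) with (PI / 3) by field; rewrite sin_PI3.
assert (17 / 10 <= sqrt 3); [| lra].
rewrite <- (sqrt_square (17 / 10)) by lra; apply sqrt_le_1_alt; lra.
Qed.

Lemma cos_PI_third : cos (PI * (1 / 3)) = 1 / 2.
Proof. replace (PI * (1 / 3)) with (PI / 3) by field; apply cos_PI3. Qed.

Definition fixes_thirds (F : R -> R) : Prop :=
  F 0 = 0 /\ F (1 / 3) = 1 / 3 /\ F (2 / 3) = 2 / 3.

(** The three image arcs all have length [1 / 3], the last one ending at [F 1 = 1]. The pairwise
    products of the three square roots are thus controlled by wedges, and each square root is
    recovered from them as in P^2 = (PQ)(PT)/(QT). *)
Lemma wedge_thirds (F f : R -> R) :
  circle_lift F f -> fixes_thirds F ->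
  wedge F f 0 (1 / 3) * (sqrt (f 0) * sqrt (f (1 / 3))) = sin (PI * (1 / 3)) /\
  wedge F f (1 / 3) (2 / 3) * (sqrt (f (1 / 3)) * sqrt (f (2 / 3))) = sin (PI * (1 / 3)) /\
  wedge F f (2 / 3) 1 * (sqrt (f 0) * sqrt (f (2 / 3))) = sin (PI * (1 / 3)).
Proof.
intros HF [F0 [F1 F2]].
pose proof (lift_period _ _ HF 0) as FP; pose proof (deriv_period _ _ HF 0) as fP.
rewrite Rplus_0_l in FP, fP.
assert (s : forall x, 0 < sqrt (f x)) by (intro x; apply sqrt_lt_R0, (lift_pos _ _ HF)).
pose proof (s 0); pose proof (s (1 / 3)); pose proof (s (2 / 3)).
rewrite !wedge_sin, FP, fP, F0, F1, F2 by trivial.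
replace (2 / 3 - 1 / 3) with (1 / 3) by field.
replace (0 + 1 - 2 / 3) with (1 / 3) by field.
rewrite Rminus_0_r; repeat split; field; lra.
Qed.

(** At 0 and [1 / 3] the frame has the known directions 0 and [PI / 3], so wedges against these two
    vectors determine both coordinates at [x]. *)
Lemma frame_thirds (F f : R -> R) (x : R) :
  circle_lift F f -> fixes_thirds F ->
  frame2 F f x = wedge F f 0 x * sqrt (f 0) /\
  sin (PI * (1 / 3)) * frame1 F f x =
    wedge F f x (1 / 3) * sqrt (f (1 / 3)) + frame2 F f x / 2.
Proof.
intros HF [F0 [F1 _]].
assert (s : forall x, 0 < sqrt (f x)) by (intro z; apply sqrt_lt_R0, (lift_pos _ _ HF)).
pose proof (s 0); pose proof (s (1 / 3)); pose proof (s x).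
unfold wedge, frame1, frame2; rewrite F0, F1, cos_PI_third, Rmult_0_r, sin_0, cos_0.
split; field; lra.
Qed.

(* The frame changes sign under [x |-> x + 1]. *)
Lemma frame_bound_extend (B : R) (F f : R -> R) :
  circle_lift F f ->
  (forall x, 0 <= x < 1 ->
     Rabs (frame1 F f x - cos (PI * x)) <= B /\ Rabs (frame2 F f x - sin (PI * x)) <= B) ->
  forall x, Rabs (frame1 F f x - cos (PI * x)) <= B /\ Rabs (frame2 F f x - sin (PI * x)) <= B.
Proof.
intros HF H.
set (P := fun x =>
  Rabs (frame1 F f x - cos (PI * x)) <= B /\ Rabs (frame2 F f x - sin (PI * x)) <= B).
assert (S : forall x, P (x + 1) <-> P x).
{ intro x; unfold P, frame1, frame2; rewrite (lift_period _ _ HF), (deriv_period _ _ HF).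
  rewrite !Rmult_plus_distr_l, Rmult_1_r, !neg_cos, !neg_sin.
  replace (- cos (PI * F x) / sqrt (f x) - - cos (PI * x))
    with (- (cos (PI * F x) / sqrt (f x) - cos (PI * x))) by (unfold Rdiv; ring).
  replace (- sin (PI * F x) / sqrt (f x) - - sin (PI * x))
    with (- (sin (PI * F x) / sqrt (f x) - sin (PI * x))) by (unfold Rdiv; ring).
  rewrite !Rabs_Ropp; reflexivity. }
assert (SN : forall n x, P (x + INR n) <-> P x).
{ induction n as [|n IH]; intro x; [now rewrite Rplus_0_r|].
  rewrite S_INR, <- Rplus_assoc, S; apply IH. }
intro x; fold (P x).
destruct (frac_part_spec x) as [n Hn]; pose proof (frac_part_bounds x) as Bx.
assert (Pf : P (frac_part x)) by now apply H.
destruct (Z.le_gt_cases 0 n) as [Hn0 | Hn0].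
- replace x with (frac_part x + INR (Z.to_nat n)); [now apply SN|].
  rewrite INR_IZR_INZ, Z2Nat.id by trivial; lra.
- apply (SN (Z.to_nat (- n))).
  rewrite INR_IZR_INZ, Z2Nat.id, opp_IZR by lia.
  now replace (x + - IZR n) with (frac_part x) by lra.
Qed.

Lemma wedge_antisym (F f : R -> R) (x y : R) : wedge F f y x = - wedge F f x y.
Proof. unfold wedge; ring. Qed.

(** Closeness propagates from the wedges at the thirds to the products of pairs ([R], within
    [d = 5 / 4 * eta] of 1), to the square roots ([Sq], [4 * d]), then to the second coordinate
    ([7 * eta]); dividing by [s >= 17 / 20] gives the first. *)
Lemma frame_close (eta : R) (F f : R -> R) :
  0 < eta <= 1 / 100 -> circle_lift F f -> fixes_thirds F ->
  (forall x y, x < y < x + 1 -> Rabs (wedge F f x y - sin (PI * (y - x))) <= eta) ->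
  forall x, Rabs (frame1 F f x - cos (PI * x)) <= 16 * eta /\
            Rabs (frame2 F f x - sin (PI * x)) <= 16 * eta.
Proof.
intros He HF HT HW.
apply frame_bound_extend; trivial; intros x Hx.
destruct (wedge_thirds F f HF HT) as [E1 [E2 E3]].
destruct (frame_thirds F f x HF HT) as [U2 U1].
assert (sp : forall x, 0 < sqrt (f x)) by (intro z; apply sqrt_lt_R0, (lift_pos _ _ HF)).
pose proof (sp 0) as P0; pose proof (sp (1 / 3)) as Q0; pose proof (sp (2 / 3)) as T0.
set (P := sqrt (f 0)) in *; set (Q := sqrt (f (1 / 3))) in *; set (T := sqrt (f (2 / 3))) in *.
pose proof (HW 0 (1 / 3) ltac:(lra)) as W1; pose proof (HW (1 / 3) (2 / 3) ltac:(lra)) as W2.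
pose proof (HW (2 / 3) 1 ltac:(lra)) as W3.
replace (1 / 3 - 0) with (1 / 3) in W1 by field.
replace (2 / 3 - 1 / 3) with (1 / 3) in W2 by field.
replace (1 - 2 / 3) with (1 / 3) in W3 by field.
pose proof sin_PI_third as Hs.
set (s := sin (PI * (1 / 3))) in *.
assert (R : forall w z, w * z = s -> 0 < z -> Rabs (w - s) <= eta -> Rabs (z - 1) <= 5 / 4 * eta).
{ intros w z Ew Hz Hw; apply Rabs_le_between in Hw.
  assert (z <= 103 / 100) by nra.
  apply Rabs_le; nra. }
pose proof (R _ _ E1 ltac:(nra) W1) as R1; pose proof (R _ _ E2 ltac:(nra) W2) as R2.
pose proof (R _ _ E3 ltac:(nra) W3) as R3.
set (d := 5 / 4 * eta) in *.
assert (Hd : 0 < d <= 1 / 80) by (unfold d; lra).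
assert (Sq : forall a b c, Rabs (a - 1) <= d -> Rabs (b - 1) <= d -> Rabs (c - 1) <= d ->
  forall p, 0 < p -> p ^ 2 * c = a * b -> Rabs (p - 1) <= 4 * d).
{ intros a b c Ha Hb Hc p Hp Ep.
  apply Rabs_le_between in Ha; apply Rabs_le_between in Hb; apply Rabs_le_between in Hc.
  assert (Hab : (1 - d) ^ 2 <= a * b <= (1 + d) ^ 2).
  { split; simpl; rewrite Rmult_1_r; apply Rmult_le_compat; lra. }
  assert (1 - 4 * d <= p ^ 2 <= 1 + 4 * d) by (split; nra).
  apply Rabs_le; split; nra. }
pose proof (Sq _ _ _ R1 R3 R2 P P0 ltac:(ring)) as BP.
pose proof (Sq _ _ _ R1 R2 R3 Q Q0 ltac:(ring)) as BQ.
assert (Wx : forall y, -1 < y - x < 1 -> Rabs (wedge F f x y - sin (PI * (y - x))) <= eta).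
{ intros y Hy; destruct (Rtotal_order x y) as [L | [<- | L]].
  - apply HW; lra.
  - rewrite Rminus_diag, Rmult_0_r, sin_0; unfold wedge.
    replace (_ - _) with 0 by ring; rewrite Rabs_R0; lra.
  - rewrite wedge_antisym; replace (PI * (y - x)) with (- (PI * (x - y))) by ring.
    rewrite sin_neg; replace (_ - _) with (- (wedge F f y x - sin (PI * (x - y)))) by ring.
    rewrite Rabs_Ropp; apply HW; lra. }
assert (Mul : forall w c p, Rabs (w - c) <= eta -> Rabs c <= 1 -> Rabs (p - 1) <= 4 * d ->
  Rabs (w * p - c) <= 7 * eta).
{ intros w c p H1 H2 H3.
  replace (w * p - c) with ((w - c) * p + c * (p - 1)) by ring.
  apply (Rle_trans _ _ _ (Rabs_triang _ _)); rewrite !Rabs_mult.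
  assert (Rabs p <= 21 / 20).
  { apply Rabs_le_between in H3; apply Rabs_le; lra. }
  assert (Rabs (w - c) * Rabs p <= eta * (21 / 20))
    by (apply Rmult_le_compat; trivial using Rabs_pos).
  assert (Rabs c * Rabs (p - 1) <= 1 * (4 * d))
    by (apply Rmult_le_compat; trivial using Rabs_pos).
  unfold d in *; lra. }
assert (V2 : Rabs (frame2 F f x - sin (PI * x)) <= 7 * eta).
{ rewrite U2; apply Mul; trivial; [| apply Rabs_le, SIN_bound].
  pose proof (Wx 0 ltac:(lra)) as W0.
  rewrite wedge_antisym.
  replace (PI * (0 - x)) with (- (PI * x)) in W0 by ring; rewrite sin_neg in W0.
  rewrite <- Rabs_Ropp; replace (- _) with (wedge F f x 0 - - sin (PI * x)) by ring.
  exact W0. }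
split; [| lra].
pose proof (Mul _ _ _ (Wx (1 / 3) ltac:(lra)) ltac:(apply Rabs_le, SIN_bound) BQ) as V1.
assert (C1 : s * cos (PI * x) = sin (PI * (1 / 3 - x)) + sin (PI * x) / 2).
{ rewrite Rmult_minus_distr_l, sin_minus, cos_PI_third; fold s; field. }
assert (V1' : Rabs (s * (frame1 F f x - cos (PI * x))) <= 7 * eta + 7 * eta / 2).
{ rewrite Rmult_minus_distr_l, U1, C1.
  apply Rabs_le_between in V1; apply Rabs_le_between in V2; apply Rabs_le; lra. }
rewrite Rabs_mult, Rabs_pos_eq in V1' by lra.
pose proof (Rabs_pos (frame1 F f x - cos (PI * x))); nra.
Qed.

(** In the three-term relation for [y - h], [y], [y + h] all terms are nonnegative, so each term on
    the left is at most the right side. The coefficients are at least [2 / 3 * k] on the left and at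
    most [4 * k] on the right, whence 6. *)
Lemma wedge_harnack (r h s y : R) (F f : R -> R) :
  circle_lift F f -> r <= 1 / 2 -> 0 < h -> 2 * h <= r ->
  (forall x y, x < y <= x + r ->
     2 / 3 * sin (PI * (y - x)) <= wedge F f x y <= 2 * sin (PI * (y - x))) ->
  s <= y - h -> y + h <= s + 1 ->
  wedge F f s (y + h) <= 6 * wedge F f s y /\ wedge F f s (y - h) <= 6 * wedge F f s y.
Proof.
intros HF Hr Hh Hhr HW H1 H2.
pose proof (HW (y - h) y ltac:(lra)) as Wa; pose proof (HW y (y + h) ltac:(lra)) as Wb.
pose proof (HW (y - h) (y + h) ltac:(lra)) as Wc.
replace (y - (y - h)) with h in Wa by ring; replace (y + h - y) with h in Wb by ring.
replace (y + h - (y - h)) with (2 * h) in Wc by ring.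
replace (PI * (2 * h)) with (2 * (PI * h)) in Wc by ring; rewrite sin_2a in Wc.
pose proof (sin_PI_pos h ltac:(lra)); pose proof (COS_bound (PI * h)).
set (k := sin (PI * h)) in *.
pose proof (wedge_nonneg F f s (y - h) HF ltac:(lra)).
pose proof (wedge_nonneg F f s (y + h) HF ltac:(lra)).
pose proof (wedge_nonneg F f s y HF ltac:(lra)).
assert (T : wedge F f s (y - h) * wedge F f y (y + h) + wedge F f s (y + h) * wedge F f (y - h) y
  = wedge F f s y * wedge F f (y - h) (y + h)) by (unfold wedge; ring).
assert (Wc' : wedge F f (y - h) (y + h) <= 4 * k) by nra.
assert (wedge F f s y * wedge F f (y - h) (y + h) <= wedge F f s y * (4 * k))
  by now apply Rmult_le_compat_l.
assert (wedge F f s (y - h) * (2 / 3 * k) <= wedge F f s (y - h) * wedge F f y (y + h))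
  by (apply Rmult_le_compat_l; lra).
assert (wedge F f s (y + h) * (2 / 3 * k) <= wedge F f s (y + h) * wedge F f (y - h) y)
  by (apply Rmult_le_compat_l; lra).
assert (0 <= wedge F f s (y - h) * (2 / 3 * k)) by nra.
assert (0 <= wedge F f s (y + h) * (2 / 3 * k)) by nra.
split; apply (Rmult_le_reg_r (2 / 3 * k)); lra.
Qed.

(** A Harnack chain of [N] equal steps from [s] to [y], each at most [r / 2]; the first value is at
    most 2. *)
Lemma wedge_upper (r s y : R) (N : nat) (F f : R -> R) :
  circle_lift F f -> r <= 1 / 2 -> 2 <= INR N * r ->
  (forall x y, x < y <= x + r ->
     2 / 3 * sin (PI * (y - x)) <= wedge F f x y <= 2 * sin (PI * (y - x))) ->
  s < y < s + 1 -> wedge F f s y <= 2 * 6 ^ N.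
Proof.
intros HF Hr HN HW Hy.
assert (N0 : 0 < INR N) by (pose proof (pos_INR N); nra).
set (h := (y - s) / INR N).
assert (Eh : INR N * h = y - s) by (unfold h; field; lra).
assert (h0 : 0 < h) by nra.
assert (hr : 2 * h <= r) by nra.
assert (H : forall j, (S j <= N)%nat -> wedge F f s (s + INR (S j) * h) <= 2 * 6 ^ j).
{ induction j as [|j IH]; intro Hj.
  - pose proof (HW s (s + INR 1 * h) ltac:(simpl; lra)) as W.
    pose proof (SIN_bound (PI * (s + INR 1 * h - s))); simpl in *; lra.
  - assert (L : INR (S (S j)) <= INR N) by (apply le_INR; lia).
    pose proof (pos_INR j).
    specialize (IH ltac:(lia)).
    rewrite !S_INR in *.
    destruct (wedge_harnack r h s (s + (INR j + 1) * h) F f HF Hr h0 hr HW) as [G _];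
      [nra | nra |].
    replace (s + (INR j + 1) * h + h) with (s + (INR j + 1 + 1) * h) in G by ring.
    simpl; lra. }
destruct N as [|N]; [simpl in N0; lra|].
specialize (H N (le_n _)); rewrite Eh in H.
replace (s + (y - s)) with y in H by ring.
assert (0 < 6 ^ N) by (apply pow_lt; lra).
simpl; lra.
Qed.

(** The same chain read for lower bounds, with step [h = 1 / (3 * n)]: the first value is at least
    [2 / 3 * sin (PI * h) >= h], and each step loses at most a factor 6. *)
Lemma wedge_third_lower (r s : R) (n : nat) (F f : R -> R) :
  circle_lift F f -> r <= 1 / 2 -> 2 <= INR n * r ->
  (forall x y, x < y <= x + r ->
     2 / 3 * sin (PI * (y - x)) <= wedge F f x y <= 2 * sin (PI * (y - x))) ->
  1 <= 3 * INR n * 6 ^ n * wedge F f s (s + 1 / 3).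
Proof.
intros HF Hr Hn HW.
assert (n0 : 4 <= INR n) by (pose proof (pos_INR n); nra).
set (h := 1 / (3 * INR n)).
assert (Eh : INR n * h = 1 / 3) by (unfold h; field; lra).
assert (h0 : 0 < h) by (apply Rdiv_lt_0_compat; lra).
assert (hr : 2 * h <= r) by nra.
assert (H : forall j, (S j <= n)%nat -> h <= 6 ^ j * wedge F f s (s + INR (S j) * h)).
{ induction j as [|j IH]; intro Hj.
  - pose proof (HW s (s + INR 1 * h) ltac:(simpl; lra)) as W.
    replace (s + INR 1 * h - s) with h in W by (simpl; ring).
    pose proof (jordan_PI h ltac:(lra)); simpl in *; lra.
  - assert (L : INR (S (S j)) <= INR n) by (apply le_INR; lia).
    pose proof (pos_INR j).
    specialize (IH ltac:(lia)).
    rewrite !S_INR in *.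
    destruct (wedge_harnack r h s (s + (INR j + 1 + 1) * h) F f HF Hr h0 hr HW) as [_ G];
      [nra | |].
    { assert ((INR j + 1 + 1) * h <= INR n * h) by (apply Rmult_le_compat_r; lra); lra. }
    replace (s + (INR j + 1 + 1) * h - h) with (s + (INR j + 1) * h) in G by ring.
    assert (0 < 6 ^ j) by (apply pow_lt; lra).
    simpl; nra. }
destruct n as [|n]; [simpl in n0; lra|].
specialize (H n (le_n _)); rewrite Eh in H.
assert (0 < 6 ^ n) by (apply pow_lt; lra).
assert (0 <= wedge F f s (s + 1 / 3)) by (apply wedge_nonneg; trivial; lra).
apply Rle_trans with (3 * INR (S n) * h); [lra|].
rewrite (Rmult_assoc (3 * INR (S n))); apply Rmult_le_compat_l; [lra|].
apply (Rle_trans _ _ _ H), Rmult_le_compat_r; simpl; lra.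
Qed.

(** * Converse part *)

(** The counterpart of [frame_close] without smallness. Products of pairs lie between [1 / (2 * b)]
    and [1 / l], so P^2 = (PQ)(PT)/(QT) is at most [2 * b / l ^ 2]; the bound [J] then follows from
    p <= 1 + p^2. *)
Lemma frame_bounded (l b : R) (F f : R -> R) :
  0 < l -> 0 < b -> circle_lift F f -> fixes_thirds F ->
  (forall s y, s < y < s + 1 -> wedge F f s y <= b) ->
  (forall s, l <= wedge F f s (s + 1 / 3)) ->
  forall x,
    Rabs (frame1 F f x - cos (PI * x)) <= 2 * b * (1 + 2 * b / l ^ 2) + 1 /\
    Rabs (frame2 F f x - sin (PI * x)) <= 2 * b * (1 + 2 * b / l ^ 2) + 1.
Proof.
intros Hl Hb HF HT Hup Hlow.
apply frame_bound_extend; trivial; intros x Hx.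
destruct (wedge_thirds F f HF HT) as [E1 [E2 E3]].
destruct (frame_thirds F f x HF HT) as [U2 U1].
assert (sp : forall x, 0 < sqrt (f x)) by (intro z; apply sqrt_lt_R0, (lift_pos _ _ HF)).
pose proof (sp 0) as P0; pose proof (sp (1 / 3)) as Q0; pose proof (sp (2 / 3)) as T0.
set (P := sqrt (f 0)) in *; set (Q := sqrt (f (1 / 3))) in *; set (T := sqrt (f (2 / 3))) in *.
pose proof (Hlow 0) as L1; pose proof (Hlow (1 / 3)) as L2; pose proof (Hlow (2 / 3)) as L3.
replace (0 + 1 / 3) with (1 / 3) in L1 by field.
replace (1 / 3 + 1 / 3) with (2 / 3) in L2 by field.
replace (2 / 3 + 1 / 3) with 1 in L3 by field.
pose proof (Hup 0 (1 / 3) ltac:(lra)) as M1; pose proof (Hup (1 / 3) (2 / 3) ltac:(lra)) as M2.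
pose proof (Hup (2 / 3) 1 ltac:(lra)) as M3.
pose proof sin_PI_third as Hs; set (s := sin (PI * (1 / 3))) in *.
assert (R : forall w z, w * z = s -> 0 < z -> l <= w <= b -> 1 <= 2 * b * z /\ l * z <= 1).
{ intros w z Ew Hz Hw; split; nra. }
destruct (R _ _ E1 ltac:(nra) (conj L1 M1)) as [R1 R1'].
destruct (R _ _ E2 ltac:(nra) (conj L2 M2)) as [R2 R2'].
destruct (R _ _ E3 ltac:(nra) (conj L3 M3)) as [R3 R3'].
set (J := 1 + 2 * b / l ^ 2).
assert (l2 : 0 < l ^ 2) by (apply pow_lt; lra).
assert (EJ : l ^ 2 * (J - 1) = 2 * b) by (unfold J; field; lra).
assert (HJ : forall p u v w, 0 < p -> 0 < u -> 0 < v -> 1 <= 2 * b * w ->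
  l * u <= 1 -> l * v <= 1 -> p ^ 2 * w = u * v -> 0 < w -> p <= J).
{ intros p u v w Hp Hu Hv Hw Hlu Hlv Ep Hw0.
  assert (X : (l * u) * (l * v) <= 1 * 1) by (apply Rmult_le_compat; nra).
  assert (Y : l ^ 2 * p ^ 2 * w <= 1).
  { replace (l ^ 2 * p ^ 2 * w) with ((l * u) * (l * v)); [lra|].
    transitivity (l ^ 2 * (u * v)); [ring | rewrite <- Ep; ring]. }
  assert (Z : p ^ 2 <= J - 1).
  { apply (Rmult_le_reg_l (l ^ 2 * w)); [nra|].
    transitivity 1; [lra|].
    replace (l ^ 2 * w * (J - 1)) with (l ^ 2 * (J - 1) * w) by ring.
    rewrite EJ; exact Hw. }
  nra. }
assert (PJ : P <= J) by (apply (HJ P (P * Q) (P * T) (Q * T)); trivial; nra).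
assert (QJ : Q <= J) by (apply (HJ Q (P * Q) (Q * T) (P * T)); trivial; nra).
assert (Wx : forall y, -1 < y - x < 1 -> Rabs (wedge F f x y) <= b).
{ intros y Hy; destruct (Rtotal_order x y) as [L | [<- | L]].
  - rewrite Rabs_pos_eq; [apply Hup; lra | left; apply wedge_pos; trivial; lra].
  - unfold wedge; replace (_ - _) with 0 by ring; rewrite Rabs_R0; lra.
  - rewrite wedge_antisym, Rabs_Ropp.
    rewrite Rabs_pos_eq; [apply Hup; lra | left; apply wedge_pos; trivial; lra]. }
assert (B2 : Rabs (frame2 F f x) <= b * J).
{ rewrite U2, wedge_antisym, Rabs_mult, Rabs_Ropp, (Rabs_pos_eq P) by lra.
  apply Rmult_le_compat; try apply Rabs_pos; try lra; apply Wx; lra. }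
assert (B1 : Rabs (wedge F f x (1 / 3) * Q) <= b * J).
{ rewrite Rabs_mult, (Rabs_pos_eq Q) by lra.
  apply Rmult_le_compat; try apply Rabs_pos; try lra; apply Wx; lra. }
assert (bJ : 0 <= b * J) by (apply Rle_trans with (2 := B2), Rabs_pos).
assert (B1' : Rabs (frame1 F f x) <= 2 * (b * J)).
{ assert (Rabs (s * frame1 F f x) <= b * J + b * J / 2).
  { rewrite U1; apply Rabs_le_between in B1; apply Rabs_le_between in B2; apply Rabs_le; lra. }
  rewrite Rabs_mult, Rabs_pos_eq in H by lra.
  pose proof (Rabs_pos (frame1 F f x)); nra. }
pose proof (COS_bound (PI * x)); pose proof (SIN_bound (PI * x)).
apply Rabs_le_between in B1'; apply Rabs_le_between in B2.
split; apply Rabs_le; lra.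
Qed.

Lemma local_wedge_near_sin (a K r : R) (F f : R -> R) :
  0 < a < 1 -> 0 < K -> 0 < r <= 1 / 2 -> K * Rpower r a <= 1 / 2 -> circle_lift F f ->
  (forall x y, x < y <= x + r -> cross_ratio_near K a F f x y) ->
  forall x y, x < y <= x + r ->
  2 / 3 * sin (PI * (y - x)) <= wedge F f x y <= 2 * sin (PI * (y - x)) /\
  Rabs (wedge F f x y - sin (PI * (y - x))) <= 8 * K * ((y - x) * Rpower (y - x) a).
Proof.
intros Ha HK Hr HKr HF Hn x y Hxy.
pose proof (wedge_near_sin a K F f x y HF ltac:(lra)) as H; cbv zeta in H.
rewrite Rmin_left in H by lra.
apply H; trivial; [| apply Hn; lra].
apply Rle_trans with (2 := HKr), Rmult_le_compat_l, Rle_Rpower_l; lra.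
Qed.

(** The estimate in [y - x] applies also to the complementary arc from [y] to [x + 1], which gives
    the minimum; the summand [K] makes the inequality strict. *)
Lemma cross_ratio_log_holder (a K r B : R) (F f : R -> R) :
  0 < a < 1 -> 0 < K -> 0 < r <= 1 / 2 -> K * Rpower r a <= 1 / 2 -> circle_lift F f ->
  (forall x y, x < y <= x + r -> cross_ratio_near K a F f x y) ->
  (forall x, Rabs (frame1 F f x - cos (PI * x)) <= B /\
             Rabs (frame2 F f x - sin (PI * x)) <= B) ->
  forall x y, x < y < x + 1 -> log_holder (log_holder_const a r (8 * K) B + K) a f x y.
Proof.
intros Ha HK Hr HKr HF Hn HB.
pose proof (local_wedge_near_sin a K r F f Ha HK Hr HKr HF Hn) as HW.
assert (M : forall x y, x < y <= x + 1 ->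
  Rabs (ln (f y) - ln (f x)) <= log_holder_const a r (8 * K) B * Rpower (y - x) a).
{ apply (frame_log_holder a r (8 * K) B F f); trivial; try lra.
  - intros x y Hxy; apply HW, Hxy.
  - intro x; destruct (HW x (x + r) ltac:(lra)) as [[W _] _].
    replace (x + r - x) with r in W by ring.
    pose proof (jordan_PI r ltac:(lra)); lra.
  - apply HB.
  - apply HB. }
intros x y Hxy; unfold log_holder, Rmin; destruct Rle_dec.
- pose proof (Rpower_pos (y - x) a).
  apply Rle_lt_trans with (1 := M x y ltac:(lra)); nra.
- pose proof (Rpower_pos (1 - (y - x)) a).
  pose proof (M y (x + 1) ltac:(lra)) as M'.
  rewrite (deriv_period _ _ HF), Rabs_minus_sym in M'.
  replace (x + 1 - y) with (1 - (y - x)) in M' by ring.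
  apply Rle_lt_trans with (1 := M'); nra.
Qed.

Lemma log_holder_const_nonneg (a r E B : R) :
  0 < a < 1 -> 0 < r -> 0 <= E -> 0 <= B -> 0 <= log_holder_const a r E B.
Proof.
intros Ha Hr HE HB; unfold log_holder_const, frame_holder_const.
assert (Rpower 2 a < 2).
{ rewrite <- (Rpower_1 2) at 2 by lra; apply Rpower_lt; lra. }
pose proof (Rpower_pos (/ (r / 2)) a).
assert (0 <= (3 * (1 + B) * E + 16 * B) / (2 - Rpower 2 a)).
{ apply Rdiv_le_0_compat; [nra | lra]. }
apply Rmult_le_pos; [nra|].
apply Rdiv_le_0_compat; [nra | apply pow_lt; lra].
Qed.

Lemma converse_bounded (a K r : R) (n : nat) (F f : R -> R) :
  0 < a < 1 -> 0 < K -> 0 < r <= 1 / 2 -> K * Rpower r a <= 1 / 2 -> 2 <= INR n * r ->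
  circle_lift F f -> fixes_thirds F ->
  (forall x y, x < y <= x + r -> cross_ratio_near K a F f x y) ->
  let b := 2 * 6 ^ n in
  let l := / (3 * INR n * 6 ^ n) in
  forall x y, x < y < x + 1 ->
  log_holder (log_holder_const a r (8 * K) (2 * b * (1 + 2 * b / l ^ 2) + 1) + K) a f x y.
Proof.
intros Ha HK Hr HKr Hn HF HT HC b l.
pose proof (local_wedge_near_sin a K r F f Ha HK Hr HKr HF HC) as HW.
assert (n0 : 0 < INR n) by (pose proof (pos_INR n); nra).
assert (p6 : 0 < 6 ^ n) by (apply pow_lt; lra).
assert (X : 0 < 3 * INR n * 6 ^ n) by (repeat apply Rmult_lt_0_compat; lra).
apply (cross_ratio_log_holder a K r _ F f); trivial.
apply frame_bounded; trivial.
- now apply Rinv_0_lt_compat.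
- unfold b; lra.
- intros s y Hy; apply (wedge_upper r s y n F f); trivial; try lra.
  intros u v Huv; apply HW, Huv.
- intro s; apply (Rmult_le_reg_l (3 * INR n * 6 ^ n)); [trivial|].
  unfold l; rewrite Rinv_r by lra.
  apply (wedge_third_lower r s n F f); trivial; try lra.
  intros u v Huv; apply HW, Huv.
Qed.

(** For small [K] the scale [r = 1 / 2] can be kept fixed, and both the wedge error and the frame
    bound are proportional to [K], so that the constant tends to 0 with [K]. *)
Lemma converse_small (a K : R) (F f : R -> R) :
  0 < a < 1 -> 0 < K <= 1 / 400 -> circle_lift F f -> fixes_thirds F ->
  (forall x y, x < y < x + 1 -> cross_ratio_near K a F f x y) ->
  forall x y, x < y < x + 1 ->
  log_holder (log_holder_const a (1 / 2) (8 * K) (16 * (4 * K)) + K) a f x y.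
Proof.
intros Ha HK HF HT HC.
assert (Kp : forall m, 0 < m <= 1 / 2 -> K * Rpower m a <= K).
{ intros m Hm; pose proof (Rpower_le_1 m a ltac:(lra) ltac:(lra)); nra. }
apply (cross_ratio_log_holder a K (1 / 2) _ F f); trivial; try lra.
- pose proof (Kp (1 / 2) ltac:(lra)); lra.
- intros x y Hxy; apply HC; lra.
(* Here [eta = 4 * K]: the wedge error is at most [8 * K * m] with [m <= 1 / 2], and [K <= 1 / 400]
   ensures [eta <= 1 / 100]. *)
- apply frame_close; trivial; [lra|].
  intros x y Hxy.
  assert (Hm : 0 < Rmin (y - x) (1 - (y - x)) <= 1 / 2) by (unfold Rmin; destruct Rle_dec; lra).
  pose proof (Kp _ Hm) as Kpm.
  destruct (wedge_near_sin a K F f x y HF Hxy ltac:(lra) ltac:(lra) (HC x y Hxy)) as [_ W].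
  apply (Rle_trans _ _ _ W); nra.
Qed.

(** The normalisation only determines [F] modulo integers; with [F 0 = 0], monotonicity confines
    [F x] to (0, 1), which leaves the integer 0. *)
Lemma tilde_lift (phi : Diff1) (F f : R -> R) :
  Diff1_tilde phi -> F 0 = crep (phi (cproj 0)) ->
  (forall x, phi (cproj x) = cproj (F x)) -> circle_lift F f -> fixes_thirds F.
Proof.
intros [T0 [T1 T2]] E0 L HF.
assert (F0 : F 0 = 0) by (rewrite E0, T0; apply fp_R0).
assert (X : forall x, 0 < x < 1 -> phi (cproj x) = cproj x -> F x = x).
{ intros x Hx E; rewrite L in E; destruct (cproj_inj _ _ E) as [n Hn].
  pose proof (lift_increment F f 0 x HF ltac:(lra)) as Fx.
  assert (-1 < n < 1)%Z by (split; apply lt_IZR; lra).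
  replace n with 0%Z in Hn by lia; lra. }
repeat split; trivial; apply X; trivial; lra.
Qed.

Lemma converse_circle (a K Q eps : R) (phi : Diff1) :
  Diff1_tilde phi ->
  (forall s t, s <> t -> cdist s t < eps -> cross_ratio_bound a K phi s t) ->
  (forall F f, circle_lift F f -> fixes_thirds F ->
     (forall x y, x < y < x + 1 -> Rmin (y - x) (1 - (y - x)) < eps ->
        cross_ratio_near K a F f x y) ->
     forall x y, x < y < x + 1 -> log_holder Q a f x y) ->
  log_deriv_holder a Q phi.
Proof.
intros HT HC H s t Hst.
destruct (diff_lift phi) as [F [F0 [L HF]]].
destruct (cproj_cover s t Hst) as [x [y [-> [-> Hxy]]]].
rewrite cdist_cproj by lra.
apply (H F (fun x => cderive phi (cproj x)) HF (tilde_lift phi F _ HT F0 L HF)); trivial.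
intros u v Huv He.
pose proof (HC (cproj u) (cproj v) (cproj_neq u v Huv)) as B; unfold cross_ratio_bound in B.
rewrite (cross_ratio_lift phi F u v L HF Huv), cdist_cproj, arc_cproj in B by lra.
exact (B He).
Qed.

Lemma converse_exists (a eps K : R) :
  0 < a < 1 -> 0 < eps -> 0 < K -> exists Q : R, 0 < Q /\
  forall phi : Diff1, Diff1_tilde phi ->
    (forall s t : circle, s <> t -> cdist s t < eps -> cross_ratio_bound a K phi s t) ->
    log_deriv_holder a Q phi.
Proof.
intros Ha He HK.
(* [r0] solves [K * Rpower r0 a = 1 / 2]; halving [eps] keeps arcs of length [r] strictly inside the
   range of the hypothesis. *)
set (r0 := Rpower (/ (2 * K)) (/ a)).
assert (r0p : 0 < r0) by apply Rpower_pos.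
set (r := Rmin (1 / 2) (Rmin (eps / 2) r0)).
assert (Hr : 0 < r /\ r <= 1 / 2 /\ r <= eps / 2 /\ r <= r0).
{ unfold r, Rmin; repeat destruct Rle_dec; lra. }
assert (HKr : K * Rpower r a <= 1 / 2).
{ assert (Rpower r0 a = / (2 * K)).
  { unfold r0; rewrite Rpower_mult, Rinv_l, Rpower_1; trivial; [| lra].
    apply Rinv_0_lt_compat; lra. }
  apply Rle_trans with (K * Rpower r0 a).
  - apply Rmult_le_compat_l, Rle_Rpower_l; lra.
  - rewrite H; right; field; lra. }
destruct (INR_archimed r 2 ltac:(lra)) as [n Hn].
set (b := 2 * 6 ^ n); set (l := / (3 * INR n * 6 ^ n)).
assert (b0 : 0 < b) by (unfold b; assert (0 < 6 ^ n) by (apply pow_lt; lra); lra).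
assert (l0 : 0 < l ^ 2).
{ apply pow_lt, Rinv_0_lt_compat; pose proof (pos_INR n).
  assert (0 < INR n) by nra.
  repeat apply Rmult_lt_0_compat; try apply pow_lt; lra. }
set (B := 2 * b * (1 + 2 * b / l ^ 2) + 1).
assert (B0 : 0 <= B).
{ assert (0 <= 2 * b / l ^ 2) by (apply Rdiv_le_0_compat; lra); unfold B; nra. }
exists (log_holder_const a r (8 * K) B + K).
split.
{ pose proof (log_holder_const_nonneg a r (8 * K) B Ha ltac:(lra) ltac:(lra) B0); lra. }
intros phi HT HC; apply (converse_circle a K _ eps phi HT HC).
intros F f HF HF3 Hn'; apply (converse_bounded a K r n F f); trivial; try lra.
intros x y Hxy; apply Hn'; [lra|].
rewrite Rmin_left; lra.
Qed.

(** * Vanishing of the constants, and the theorem *)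

Lemma filterlim_at_right_0 (g h : R -> R) (c : R) :
  0 < c -> ex_derive g 0 -> g 0 = 0 -> (forall x, 0 < x < c -> h x = g x) ->
  filterlim h (at_right 0) (locally 0).
Proof.
intros Hc Dg g0 Hh.
apply (filterlim_ext_loc g).
- exists (mkposreal c Hc); intros x Hx x0.
  apply Rabs_def2 in Hx; unfold minus, plus, opp in Hx; simpl in Hx.
  symmetry; apply Hh; lra.
- pose proof (ex_derive_continuous g 0 Dg) as Cg; unfold continuous in Cg; rewrite g0 in Cg.
  intros P HP; destruct (Cg P HP) as [d Hd]; exists d; auto.
Qed.

Theorem theorem3 (alpha : R) (halpha : 0 < alpha < 1) :
  (* direct part *)
  ((forall C : R, 0 < C -> exists C' : R, 0 < C' /\
      forall phi : Diff1, log_deriv_holder alpha C phi ->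
        Hol alpha C' (PSL_class phi))
   /\
   (exists C' : R -> R,
      (forall C : R, 0 < C -> 0 < C' C /\
         forall phi : Diff1, log_deriv_holder alpha C phi ->
           Hol alpha (C' C) (PSL_class phi)) /\
      filterlim C' (at_right 0) (locally 0)))
  /\
  (* converse part *)
  (forall eps : R, 0 < eps ->
     (forall C' : R, 0 < C' -> exists C'' : R, 0 < C'' /\
        forall phi : Diff1, Diff1_tilde phi ->
          (forall s t : circle, s <> t -> cdist s t < eps ->
             cross_ratio_bound alpha C' phi s t) ->
          log_deriv_holder alpha C'' phi)
     /\
     (1 < eps -> exists C'' : R -> R,
        (forall C' : R, 0 < C' -> 0 < C'' C' /\
           forall phi : Diff1, Diff1_tilde phi ->
             (forall s t : circle, s <> t -> cdist s t < eps ->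
                cross_ratio_bound alpha C' phi s t) ->
             log_deriv_holder alpha (C'' C') phi) /\
        filterlim C'' (at_right 0) (locally 0))).
Proof.
assert (Direct : forall C, 0 < C -> 0 < 132 * (exp C * (exp C - 1)) /\
  forall phi : Diff1, log_deriv_holder alpha C phi ->
    Hol alpha (132 * (exp C * (exp C - 1))) (PSL_class phi)).
{ intros C HC; split.
  - pose proof (exp_ineq1_le C); pose proof (exp_pos C); nra.
  - intros phi H; now apply direct_part. }
split; [split|].
- intros C HC; eexists; exact (Direct C HC).
- exists (fun C => 132 * (exp C * (exp C - 1))); split; [exact Direct|].
  apply (filterlim_at_right_0 (fun C => 132 * (exp C * (exp C - 1))) _ 1); trivial; try lra.
  + auto_derive; trivial.
  + rewrite exp_0; ring.
- intros eps He; split.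
  { intros K HK; exact (converse_exists alpha eps K halpha He HK). }
  intro He1.
  set (P := fun K Q => 0 < Q /\ forall phi : Diff1, Diff1_tilde phi ->
    (forall s t : circle, s <> t -> cdist s t < eps -> cross_ratio_bound alpha K phi s t) ->
    log_deriv_holder alpha Q phi).
  set (g := fun K => log_holder_const alpha (1 / 2) (8 * K) (16 * (4 * K)) + K).
  (* The limit only sees small [K], where the constant is explicit; elsewhere a constant is chosen
     among those given by [converse_exists]. *)
  exists (fun K => if Rlt_dec K (1 / 400) then g K else epsilon (inhabits 0) (P K)); split.
  + intros K HK; destruct Rlt_dec as [Hlt | Hge].
    * split.
      { pose proof (log_holder_const_nonneg alpha (1 / 2) (8 * K) (16 * (4 * K))
          halpha ltac:(lra) ltac:(lra) ltac:(lra)); unfold g; lra. }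
      intros phi HT HC; apply (converse_circle alpha K _ eps phi HT HC).
      intros F f HF HF3 Hn; apply (converse_small alpha K F f); trivial; [lra|].
      intros x y Hxy; apply Hn; trivial.
      (* Circle distances are at most [1 / 2], so [1 < eps] makes the hypothesis global. *)
      unfold Rmin; destruct Rle_dec; lra.
    * apply (epsilon_spec (inhabits 0) (P K)), converse_exists; trivial.
  + apply (filterlim_at_right_0 g _ (1 / 400)).
    * lra.
    * unfold g, log_holder_const, frame_holder_const; auto_derive.
      assert (Rpower 2 alpha < 2); [| lra].
      rewrite <- (Rpower_1 2) at 2 by lra; apply Rpower_lt; lra.
    * unfold g, log_holder_const, frame_holder_const, Rdiv; ring.
    * intros x Hx; destruct Rlt_dec; [reflexivity | lra].
Qed.
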